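(* Let $u\in V$ be a steady Navier-Stokes solution, i.e. $\nu(\nabla u,\nabla v)+b(u,u,v)=\langle f,v\rangle$ for all $v\in V$, with $K_1:=\|\nabla u\|_{L^\infty(\Omega)}<\infty$, and suppose $I_H(u)$ is known. Let $u_0\in V$ and let $(u_k)_{k\ge 0}\subset V$ be the CDA-Picard iterates with exact data, defined by $$\nu(\nabla u_{k+1},\nabla v)+b(u_k,u_{k+1},v)+\mu(I_Hu_{k+1}-I_Hu,\,I_Hv)=\langle f,v\rangle\qquad\forall v\in V .$$ Set $$\gamma:=\frac{1}{K_1}\min\left\{\frac{\nu}{C_I^2H^2},\ \mu\right\},$$ and suppose $\mu>2K_1$ and $H<\dfrac{\nu^{1/2}}{(2K_1)^{1/2}C_I}$. Then for every $k\ge 0$ $$\|u_{k+1}-u\|\le\frac{\sqrt2}{\sqrt\gamma}\,\|u_k-u\| .$$ Moreover $\gamma>2$, so CDA-Picard converges linearly to $u$ in $L^2$, and the convergence is faster (the contraction factor $\sqrt{2/\gamma}$ is smaller) whenever $H$ decreases and $\mu$ increases.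
   Context: $\Omega\subset\mathbb{R}^d$, $d\in\{2,3\}$, is an open connected set that is a convex polygon or has smooth boundary. $(\cdot,\cdot)$ and $\|\cdot\|$ denote the $L^2(\Omega)$ inner product and norm. $X=\{v\in H^1(\Omega)^d: v=0\text{ on }\partial\Omega\}$, $Q=\{q\in L^2(\Omega):\int_\Omega q\,dx=0\}$, $V=\{v\in X:(\nabla\cdot v,q)=0\ \forall q\in Q\}$ (the divergence-free subspace). $\nu>0$ is the viscosity, $f\in H^{-1}(\Omega)^d$ is the forcing, and $\langle f,v\rangle$ is the duality pairing. $b(u,w,v)=((u\cdot\nabla)w,v)$. Data assimilation: $H>0$ is the width of a coarse mesh of $\Omega$, and $I_H$ is a (linear) coarse mesh interpolation operator for which there is a constant $C_I>0$ independent of $H$ with $\|I_Hv-v\|\le C_IH\|\nabla v\|$ and $\|I_Hv\|\le C_I\|v\|$ for all $v\in X$. $\mu>0$ is the nudging parameter. The assumption $K_1<\infty$ is a standing assumption of the paper on the Navier-Stokes solutions considered ($f$ is assumed sufficiently regular for this). *)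

(* Defs.v *)
From HB Require Import structures.
From mathcomp Require Import all_boot all_order all_algebra.
From mathcomp Require Import all_classical all_reals all_analysis.

Set Implicit Arguments.
Unset Strict Implicit.
Unset Printing Implicit Defensive.
Import Order.TTheory GRing.Theory Num.Theory.
Import numFieldNormedType.Exports.

Local Open Scope classical_set_scope.
Local Open Scope ring_scope.

(* Product sigma-algebra on matrices: the smallest one making all entries
   measurable. *)
Section measurable_matrix.
Context {R : realType} (m n : nat).

Definition mx_cylinders : set (set 'M[R]_(m, n)) :=
  [set A | exists (i : 'I_m) (j : 'I_n) (B : set R),
     measurable B /\ A = [set M : 'M[R]_(m, n) | B (M i j)]].

Let mx_set0 : <<s mx_cylinders >> set0.
Proof. exact: sigma_algebra0. Qed.

Let mx_setC A : <<s mx_cylinders >> A -> <<s mx_cylinders >> (~` A).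
Proof. exact: sigma_algebraC. Qed.

Let mx_bigcup (F : (set 'M[R]_(m, n))^nat) :
  (forall i, <<s mx_cylinders >> (F i)) ->
  <<s mx_cylinders >> (\bigcup_i (F i)).
Proof. exact: sigma_algebra_bigcup. Qed.

HB.instance Definition _ := @isMeasurable.Build default_measure_display
  'M[R]_(m, n) <<s mx_cylinders >> mx_set0 mx_setC mx_bigcup.

Lemma measurable_mx_entry (i : 'I_m) (j : 'I_n) :
  measurable_fun [set: 'M[R]_(m, n)] (fun M => M i j).
Proof.
move=> _ B mB; rewrite setTI; apply: sub_sigma_algebra.
by exists i, j, B.
Qed.

Lemma measurable_fun_mx d (T : measurableType d) (f : T -> 'M[R]_(m, n)) :
  (forall i j, measurable_fun setT (fun x => f x i j)) ->
  measurable_fun setT f.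
Proof.
move=> mf _ A; rewrite setTI.
rewrite /measurable/= => /(_ [set A | measurable (f @^-1` A)]); apply.
split.
  split => /=.
  - by rewrite preimage_set0.
  - by move=> B mB; rewrite setTD preimage_setC; exact: measurableC.
  - by move=> F mF; rewrite preimage_bigcup; exact: bigcup_measurable.
move=> _ [i [j [B [mB ->]]]] /=.
by rewrite -[X in measurable X]setTI; exact: (mf i j).
Qed.
End measurable_matrix.

(* Lebesgue measure on R^n, as the n-fold product of the one-dimensional one;
   [lebesgue_rV_box] is its characteristic property. *)
Section lebesgue_rV.
Context {R : realType}.

Definition rV_cons n (p : R * 'rV[R]_n) : 'rV[R]_n.+1 :=
  \row_j (if unlift ord0 j is Some k then p.2 ord0 k else p.1).

Lemma measurable_rV_cons n : measurable_fun setT (@rV_cons n).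
Proof.
apply: measurable_fun_mx => i j.
case: (unliftP ord0 j) => [k ->|->].
- rewrite [X in measurable_fun _ X](_ : _ =
    (fun M : 'rV[R]_n => M ord0 k) \o snd).
    by apply: measurableT_comp => //; exact: measurable_mx_entry.
  by apply/funext => p; rewrite mxE liftK.
- rewrite [X in measurable_fun _ X](_ : _ = fst); first exact: measurable_fst.
  by apply/funext => p; rewrite mxE unlift_none.
Qed.

Definition rV_uncons n (x : 'rV[R]_n.+1) : R * 'rV[R]_n :=
  (x ord0 ord0, \row_j x ord0 (lift ord0 j)).

Lemma rV_consK n : cancel (@rV_cons n) (@rV_uncons n).
Proof.
move=> [x t]; rewrite /rV_uncons !mxE unlift_none; congr pair.
by apply/rowP => j; rewrite !mxE liftK.
Qed.

Lemma rV_unconsK n : cancel (@rV_uncons n) (@rV_cons n).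
Proof.
move=> x; apply/rowP => j; rewrite mxE.
by case: (unliftP ord0 j) => [k ->|->] //=; rewrite mxE.
Qed.

Lemma measurable_rV_uncons n : measurable_fun setT (@rV_uncons n).
Proof.
apply/measurable_fun_pairP; split; first exact: measurable_mx_entry.
apply: measurable_fun_mx => i j.
rewrite [X in measurable_fun _ X](_ : _ =
    (fun M : 'rV[R]_n.+1 => M ord0 (lift ord0 j))).
  exact: measurable_mx_entry.
by apply/funext => p; rewrite /= mxE.
Qed.

Section step.
Context (n : nat) (mu : {sigma_finite_measure set 'rV[R]_n -> \bar R}).

Definition lebesgue_rV_step : set 'rV[R]_n.+1 -> \bar R :=
  pushforward (@lebesgue_measure R \x mu)%E (@rV_cons n).

HB.instance Definition _ := Measure.copy lebesgue_rV_step
  (measure_function_pushforward__canonical__measure_function_Measure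
    (@lebesgue_measure R \x mu)%E (measurable_rV_cons (n:=n))).

Lemma lebesgue_rV_stepE (A : set (measurableTypeR R * 'rV[R]_n)) :
  lebesgue_rV_step (@rV_uncons n @^-1` A) = (@lebesgue_measure R \x mu)%E A.
Proof.
rewrite /lebesgue_rV_step /pushforward; congr (_ _).
by apply/seteqP; split => p; rewrite /preimage /= rV_consK.
Qed.

Let sigma_finite_step : sigma_finite setT lebesgue_rV_step.
Proof.
have /sigma_finiteP[F [TF ndF Foo]] := sigma_finiteT (@lebesgue_measure R).
have /sigma_finiteP[G [TG ndG Goo]] := sigma_finiteT mu.
exists (fun k => @rV_uncons n @^-1` (F k `*` G k)).
  rewrite -preimage_bigcup (_ : \bigcup_k _ = setT) ?preimage_setT//.
  rewrite -subTset => -[x y] _.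
  have [k _ Fk] : (\bigcup_k F k) x by rewrite -TF.
  have [l _ Gl] : (\bigcup_k G k) y by rewrite -TG.
  exists (maxn k l) => //; split => /=.
    by move: x Fk; exact/subsetPset/ndF/leq_maxl.
  by move: y Gl; exact/subsetPset/ndG/leq_maxr.
move=> k; have [mF Fk] := Foo k; have [mG Gk] := Goo k; split.
  rewrite -[X in measurable X]setTI; apply: measurable_rV_uncons => //.
  exact: measurableX.
rewrite lebesgue_rV_stepE product_measure1E//.
by rewrite lte_mul_pinfty// ge0_fin_numE.
Qed.

HB.instance Definition _ := Measure_isSigmaFinite.Build _ _ _
  lebesgue_rV_step sigma_finite_step.

End step.

Fixpoint lebesgue_rV n : {sigma_finite_measure set 'rV[R]_n -> \bar R} :=
  if n is n'.+1 then lebesgue_rV_step (lebesgue_rV n') else \d_(0 : 'rV[R]_0).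

Lemma lebesgue_rV_box n (A : 'I_n -> set R) :
  (forall i, measurable (A i)) ->
  lebesgue_rV n [set x | forall i, A i (x ord0 i)] =
  (\prod_(i < n) lebesgue_measure (A i))%E.
Proof.
elim: n A => [|n IHn] A mA.
  by rewrite big_ord0 /= diracE mem_set//= => -[].
pose B := [set x : 'rV[R]_n | forall i, A (lift ord0 i) (x ord0 i)].
have mB : measurable B.
  rewrite (_ : B = \bigcap_(i in [set: 'I_n])
      ((fun x : 'rV[R]_n => x ord0 i) @^-1` A (lift ord0 i))).
    apply: fin_bigcap_measurable => // i _.
    by rewrite -[X in measurable X]setTI; exact: measurable_mx_entry.
  by apply/seteqP; split => x Bx i; [move=> _|]; exact: Bx.
rewrite big_ord_recl -IHn//=.
have := lebesgue_rV_stepE (lebesgue_rV n) (A ord0 `*` B).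
rewrite product_measure1E//; last exact: mA.
move=> <-.
congr (lebesgue_rV_step _ _); apply/seteqP; split => x /=.
  by move=> Ax; split => [|i] /=; [exact: Ax|rewrite mxE; exact: Ax].
move=> [/= A0 Bx] i; case: (unliftP ord0 i) => [j ->|-> //].
by have := Bx j; rewrite mxE.
Qed.
End lebesgue_rV.

Section smooth_functions.
Context {R : realType}.

Definition partial n (i : 'I_n) (f : 'rV[R]_n -> R) : 'rV[R]_n -> R :=
  fun x => 'D_(delta_mx ord0 i) f x.

Fixpoint Ck n (k : nat) (f : 'rV[R]_n -> R) : Prop :=
  continuous f /\
  if k is k'.+1 then
    forall i, (forall x, derivable f x (delta_mx ord0 i)) /\ Ck k' (partial i f)
  else True.

Definition smooth n (f : 'rV[R]_n -> R) : Prop := forall k, Ck k f.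

(* Row i, column j is the i-th partial derivative of the j-th component, so that
   (u . grad) w is the row vector u *m grad w and div w is the trace. *)
Definition gradient n (phi : 'rV[R]_n -> 'rV[R]_n) : 'rV[R]_n -> 'M[R]_n :=
  fun x => \matrix_(i, j) partial i (fun y => phi y ord0 j) x.

End smooth_functions.

(* Entrywise inner product; its square root on the diagonal is the Euclidean
   (Frobenius) norm, whereas the norm of the library on matrices is the maximum
   norm. *)
Definition mxdot {R : realType} m n (A B : 'M[R]_(m, n)) : R :=
  \sum_i \sum_j A i j * B i j.

Section domains.
Context {R : realType} (d : nat).
Implicit Type Omega : set 'rV[R]_d.

(* A convex polygon for d = 2, a convex polyhedron for d = 3. *)
Definition convex_polytope Omega : Prop :=
  bounded_set Omega /\
  exists (m : nat) (a : 'I_m -> 'rV[R]_d) (b : 'I_m -> R),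
    Omega = [set x | forall i, mxdot (a i) x < b i].

(* Near each boundary point Omega is, after choosing a coordinate axis i and an
   orientation s, the region above the graph of a smooth function of the other
   coordinates. *)
Definition smooth_boundary Omega : Prop :=
  forall p, (closure Omega `\` interior Omega) p ->
  exists (i : 'I_d) (s : bool) (g : 'rV[R]_(d.-1) -> R), smooth g /\
    \forall x \near p, Omega x <-> g (col' i x) < (-1) ^+ s * x ord0 i.

End domains.

Section function_spaces.
Context {R : realType} {d : nat} (Omega : set 'rV[R]_d).
Local Notation E := 'rV[R]_d.
Local Notation leb := (@lebesgue_rV R d).

Definition L2 m n (F : E -> 'M[R]_(m, n)) : Prop :=
  measurable_fun Omega F /\
  leb.-integrable Omega (fun x => (mxdot (F x) (F x))%:E).

Definition L2ip m n (F G : E -> 'M[R]_(m, n)) : R :=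
  \int[leb]_(x in Omega) mxdot (F x) (G x).

Definition L2norm m n (F : E -> 'M[R]_(m, n)) : R := Num.sqrt (L2ip F F).

Definition Linfnorm m n (F : E -> 'M[R]_(m, n)) : \bar R :=
  'N[leb]_+oo [(fun x => (Num.sqrt (mxdot (F x) (F x)))%:E) \_ Omega]%E.

Definition test_fun (phi : E -> R) : Prop :=
  smooth phi /\
  exists K, [/\ compact K, K `<=` Omega & forall x, ~ K x -> phi x = 0].

(* An element of H^1(Omega)^d, given by representatives of the function and of
   its weak gradient (same index convention as [gradient]). *)
Record H1 := MkH1 {
  h1_fun :> E -> 'rV[R]_d;
  h1_grad : E -> 'M[R]_d;
  h1_funL2 : L2 h1_fun;
  h1_gradL2 : L2 h1_grad;
  h1_weak_grad : forall (phi : E -> R) (i j : 'I_d), test_fun phi ->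
    \int[leb]_(x in Omega) (h1_fun x ord0 j * partial i phi x) =
    - \int[leb]_(x in Omega) (h1_grad x i j * phi x) }.

Definition H1norm (F : E -> 'rV[R]_d) (DF : E -> 'M[R]_d) : R :=
  Num.sqrt (L2norm F ^+ 2 + L2norm DF ^+ 2).

(* "v = 0 on the boundary" is meant in the usual sense of H^1_0: v is a limit in
   H^1 of smooth fields with compact support in Omega. *)
Definition spaceX (v : H1) : Prop :=
  forall eps : R, 0 < eps ->
  exists phi : E -> 'rV[R]_d,
    (forall j, test_fun (fun x => phi x ord0 j)) /\
    H1norm (fun x => v x - phi x) (fun x => h1_grad v x - gradient phi x) < eps.

(* The integral is the extended-real one: its vanishing entails integrability. *)
Definition spaceQ (q : E -> R) : Prop :=
  [/\ measurable_fun Omega q,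
      leb.-integrable Omega (fun x => (q x ^+ 2)%:E) &
      (\int[leb]_(x in Omega) (q x)%:E = 0)%E].

Definition divergence (v : H1) : E -> R := fun x => \tr (h1_grad v x).

Definition spaceV (v : H1) : Prop :=
  spaceX v /\
  forall q, spaceQ q -> \int[leb]_(x in Omega) (divergence v x * q x) = 0.

Definition bform (u w v : H1) : R := L2ip (fun x => u x *m h1_grad w x) v.

(* Bounded linear functionals on X, as functions of the underlying field. *)
Definition Hminus1 (f : (E -> 'rV[R]_d) -> R) : Prop :=
  (forall (a : R) (v w : H1), spaceX v -> spaceX w ->
     f (fun x => a *: v x + w x) = a * f v + f w) /\
  exists C : R, forall v : H1, spaceX v -> `|f v| <= C * H1norm v (h1_grad v).

Definition coarse_interpolation (CI H : R)
    (IH : (E -> 'rV[R]_d) -> (E -> 'rV[R]_d)) : Prop :=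
  [/\ forall v : H1, spaceX v -> L2 (IH v),
      forall (a : R) (v w : H1), spaceX v -> spaceX w ->
        {ae leb, forall x, Omega x ->
          IH (fun y => a *: v y + w y) x = a *: IH v x + IH w x},
      forall v : H1, spaceX v ->
        L2norm (fun x => IH v x - v x) <= CI * H * L2norm (h1_grad v) &
      forall v : H1, spaceX v -> L2norm (IH v) <= CI * L2norm v].

Definition steady_NS (nu : R) (f : (E -> 'rV[R]_d) -> R) (u : H1) : Prop :=
  spaceV u /\
  forall v : H1, spaceV v ->
    nu * L2ip (h1_grad u) (h1_grad v) + bform u u v = f v.

Definition CDA_Picard (nu mu : R) (f : (E -> 'rV[R]_d) -> R)
    (IH : (E -> 'rV[R]_d) -> (E -> 'rV[R]_d)) (u : H1) (u_ : nat -> H1) : Prop :=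
  (forall k, spaceV (u_ k)) /\
  forall k (v : H1), spaceV v ->
    nu * L2ip (h1_grad (u_ k.+1)) (h1_grad v) + bform (u_ k) (u_ k.+1) v
    + mu * L2ip (fun x => IH (u_ k.+1) x - IH u x) (IH v) = f v.

End function_spaces.

(* For K1 = 0, which the division rules out, the library convention 0^-1 = 0 makes
   the condition H < sqrt nu / (sqrt (2 K1) CI) read H < 0. *)
Definition cda_gamma {R : realType} (nu CI K1 H mu : R) : R :=
  K1^-1 * Num.min (nu / (CI ^+ 2 * H ^+ 2)) mu.

(* Main.v *)
Require Import Defs.
From HB Require Import structures.
From mathcomp Require Import all_boot all_order all_algebra.
From mathcomp Require Import all_classical all_reals all_analysis.
From mathcomp Require Import measurable_realfun ess_sup_inf ring lra.

Set Implicit Arguments.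
Unset Strict Implicit.
Unset Printing Implicit Defensive.
Import Order.TTheory GRing.Theory Num.Theory.
Import numFieldNormedType.Exports.

Local Open Scope classical_set_scope.
Local Open Scope ring_scope.

(** Subtract the equation of [u] from the equation of the iterate [u_ k.+1] and
test with the error e = u_(k+1) - u. With r = u_k - u this gives

  nu |grad e|^2 + mu |I_H e|^2 + b(u_k, e, e) = - b(r, u, e).

The convective term b(u_k, e, e) vanishes, since u_k is divergence free and e
vanishes on the boundary, and the right-hand side is at most
K1 |r| |e| <= K1/2 (|r|^2 + |e|^2); this is [picard_energy]. Conversely the
interpolation estimate controls the whole error by the two dissipative terms,
|e|^2 <= 2 CI^2 H^2 |grad e|^2 + 2 |I_H e|^2 ([interpolation_split]). With
lam = min (nu / (CI^2 H^2)) mu = K1 gamma the two estimates combine into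
lam |e|^2 <= K1 (|r|^2 + |e|^2). The conditions on mu and H say exactly that
2 K1 < lam, so that K1 |e|^2 can be absorbed on the left, and
|e|^2 <= (2 / gamma) |r|^2 ([energy_contraction]).

The substance of the proof is that b(u, e, e) exists and vanishes for u in V and
e in H^1_0 ([convection_eq0]). The identity (u A) . v = A : (u^T v) writes
b(u, w, v) as the L^2 inner product of grad w with the outer product u^T v, so
that b is continuous as soon as u^T v is square integrable with a bound in terms
of the H^1 norms, that is, as soon as H^1_0 embeds into L^4. This is where the
dimension matters. For compactly supported functions the embedding is
Ladyzhenskaya's inequality: f^2 is bounded by the integral of 2 |f f_i| along the
i-th axis, and in the plane the product of the two bounds is a product of
functions of one variable each ([ladyzhenskaya2]); in space this is applied on
the slices x_0 = t, whose L^2 norm is bounded uniformly in t by the same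
one-dimensional argument ([integral_pow4_le_energy3]). A truncation carries the
bound to limits of test fields ([integral_pow4_le_H1sq]).

For a test field phi, b(u, phi, phi) is turned into the integral of
- (div u) |phi|^2 / 2 by the weak gradient of u tested with the squares of the
components of phi ([convection_test_eq0]). The divergence of u is only known to
be orthogonal to functions of mean zero, and a correction by multiples of
indicator functions shows that it is orthogonal to all g in L^1 and L^2
([integral_divergenceM_eq0]): if Omega has finite measure because the integral of
div u is zero for u in H^1_0, and otherwise because the mean of g over sets of
large measure is negligible. *)

(** * Borel sets of matrices *)

(** The entries generate the sigma-algebra, so a box is measurable, and an open
set is the countable union of the boxes with rational centre and radius of the form
1 / (k + 1) that it contains. *)
Lemma open_measurable_mx (R : realType) m n (A : set 'M[R]_(m, n)) :
  open A -> measurable A.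
Proof.
move=> oA.
pose U (p : 'M[rat]_(m, n) * nat) := [set M : 'M[R]_(m, n) |
  forall i j, M i j \in `](ratr (p.1 i j) - p.2.+1%:R^-1), (ratr (p.1 i j) + p.2.+1%:R^-1)[].
have mU p : measurable (U p).
  rewrite (_ : U p = \bigcap_(i in [set: 'I_m]) \bigcap_(j in [set: 'I_n])
      ((fun M : 'M[R]_(m, n) => M i j) @^-1`
        [set` `](ratr (p.1 i j) - p.2.+1%:R^-1), (ratr (p.1 i j) + p.2.+1%:R^-1)[])).
    apply: fin_bigcap_measurable => // i _.
    apply: fin_bigcap_measurable => // j _.
    rewrite -[X in measurable X]setTI.
    by apply: (measurable_mx_entry i j measurableT); exact: measurable_itv.
  by apply/seteqP; split => [M UM i _ j _|M UM i j]; exact: UM.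
rewrite (_ : A = \bigcup_(p in [set: 'M[rat]_(m, n) * nat])
   (if pselect (U p `<=` A) then U p else set0)); last first.
  apply/seteqP; split; last first.
    by move=> M [p _]; case: pselect => [UA|_ []//]; exact: UA.
  move=> M AM; have /nbhs_ballP[e /= e0 eA] := oA _ AM.
  have [k _ ke] := near_infty_natSinv_lt (PosNum (divr_gt0 e0 (ltr0n _ 2))).
  have {}ke : k.+1%:R^-1 < e / 2 by exact: (ke k (leqnn k)).
  have k0 : 0 < k.+1%:R^-1 :> R by rewrite invr_gt0.
  have q_ i j : exists q : rat, ratr q \in `](M i j - k.+1%:R^-1), (M i j + k.+1%:R^-1)[.
    by apply: rat_in_itvoo; rewrite ltrBlDr -addrA ltrDl addr_gt0.
  pose q := \matrix_(i, j) projT1 (cid (q_ i j)).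
  have qE i j : ratr (q i j) \in `](M i j - k.+1%:R^-1), (M i j + k.+1%:R^-1)[.
    by rewrite mxE; case: cid.
  exists (q, k) => //; case: pselect => [?|[]].
    move=> i j; have := qE i j; rewrite /= !in_itv /= => /andP[q1 q2].
    by apply/andP; split; move: q1 q2; set z := _^-1; lra.
  move=> N UN; apply: eA; split=> // i j; rewrite /ball /=.
  have := qE i j; have := UN i j; rewrite !in_itv /= ltr_norml.
  by move: ke; set z := _^-1; lra.
apply: countable_bigcupT_measurable => // p.
by case: pselect => ?; [exact: mU|exact: measurable0].
Qed.

Lemma continuous_measurable_mx (R : realType) m n (f : 'M[R]_(m, n) -> R) :
  continuous f -> measurable_fun setT f.
Proof.
move=> /continuousP cf; apply: (measurability _ (RGenOpens.measurableE R)).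
move=> _ [_ [a [b ->] <-]]; rewrite setTI.
apply: open_measurable_mx; apply: cf; exact: interval_open.
Qed.

(** * Square-integrable matrix fields *)

Section mxdot_theory.
Context {R : realType} (m n : nat).
Implicit Types A B C : 'M[R]_(m, n).

Lemma mxdotC A B : mxdot A B = mxdot B A.
Proof. by apply: eq_bigr => i _; apply: eq_bigr => j _; rewrite mulrC. Qed.

Lemma mxdotDl A B C : mxdot (A + B) C = mxdot A C + mxdot B C.
Proof.
rewrite /mxdot -big_split; apply: eq_bigr => i _.
by rewrite -big_split; apply: eq_bigr => j _; rewrite mxE mulrDl.
Qed.

Lemma mxdotZl a A B : mxdot (a *: A) B = a * mxdot A B.
Proof.
rewrite /mxdot mulr_sumr; apply: eq_bigr => i _.
by rewrite mulr_sumr; apply: eq_bigr => j _; rewrite mxE mulrA.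
Qed.

Lemma mxdotDr A B C : mxdot C (A + B) = mxdot C A + mxdot C B.
Proof. by rewrite mxdotC mxdotDl !(mxdotC C). Qed.

Lemma mxdotZr a A B : mxdot A (a *: B) = a * mxdot A B.
Proof. by rewrite mxdotC mxdotZl mxdotC. Qed.

Lemma mxdot_ge0 A : 0 <= mxdot A A.
Proof. by apply: sumr_ge0 => i _; apply: sumr_ge0 => j _; rewrite -expr2 sqr_ge0. Qed.

(** Stated without the factor 1/2: it is used for integrability only. *)
Lemma mxdot_young A B : `|mxdot A B| <= mxdot A A + mxdot B B.
Proof.
have := mxdot_ge0 (A + B); have := mxdot_ge0 (A + (-1) *: B).
have := mxdot_ge0 A; have := mxdot_ge0 B.
rewrite !(mxdotDl, mxdotDr, mxdotZl, mxdotZr) (mxdotC B A) => *.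
by rewrite ler_norml; lra.
Qed.

Lemma mxdot_add_le A B : mxdot (A + B) (A + B) <= 2 * mxdot A A + 2 * mxdot B B.
Proof.
have := mxdot_ge0 (A + (-1) *: B).
by rewrite !(mxdotDl, mxdotDr, mxdotZl, mxdotZr) (mxdotC B A) => *; lra.
Qed.

End mxdot_theory.

(** The case a = 0 is allowed; there the polynomial is affine, hence b = 0. *)
Lemma discriminant_le (R : realFieldType) (a b c : R) :
  0 <= a -> (forall t, 0 <= t ^+ 2 * a + 2 * t * b + c) -> b ^+ 2 <= a * c.
Proof.
rewrite le0r => /orP[/eqP a00|apos] h.
  have h1 t : 0 <= 2 * t * b + c by have := h t; rewrite a00 mulr0 add0r.
  suff -> : b = 0 by rewrite a00 mul0r expr0n.
  have c0 : 0 <= c by have := h1 0; lra.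
  apply/eqP/negPn/negP => b0.
  have := h1 (- (c + 1) / (2 * b)).
  have -> : 2 * (- (c + 1) / (2 * b)) * b = - (c + 1) by field.
  lra.
(* the value at the minimum of the polynomial *)
have := h (- b / a).
have -> : (- b / a) ^+ 2 * a + 2 * (- b / a) * b + c = (a * c - b ^+ 2) / a.
  by field; rewrite gt_eqF.
by rewrite pmulr_lge0 ?invr_gt0// subr_ge0.
Qed.

Section L2_theory.
Context {R : realType} {d : nat} {Omega : set 'rV[R]_d}.
Hypothesis mO : measurable Omega.
Local Notation E := 'rV[R]_d.
Local Notation leb := (@lebesgue_rV R d).

Lemma measurable_fun_entry m n (F : E -> 'M[R]_(m, n)) i j :
  measurable_fun Omega F -> measurable_fun Omega (fun x => F x i j).
Proof. by move=> mF; apply: (measurableT_comp (measurable_mx_entry i j)). Qed.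

Lemma measurable_fun_mxdot m n (F G : E -> 'M[R]_(m, n)) :
  measurable_fun Omega F -> measurable_fun Omega G ->
  measurable_fun Omega (fun x => mxdot (F x) (G x)).
Proof.
move=> mF mG; apply: measurable_sum => i; apply: measurable_sum => j.
by apply: measurable_funM; exact: measurable_fun_entry.
Qed.

(** Measurability on a subset, tested on the generators of the
sigma-algebra. *)
Lemma measurable_fun_mx_on m n (F : E -> 'M[R]_(m, n)) :
  (forall i j, measurable_fun Omega (fun x => F x i j)) -> measurable_fun Omega F.
Proof.
move=> mF _ A.
rewrite /measurable/= => /(_ [set A | measurable (Omega `&` F @^-1` A)]); apply.
split.
  split => /=.
  - by rewrite preimage_set0 setI0.
  - move=> B mB; rewrite setTD preimage_setC -setDE.
    by rewrite -(set0U (Omega `\` _)) -(setDv Omega) -setDIr; exact: measurableD.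
  - by move=> G mG; rewrite preimage_bigcup setI_bigcupr; exact: bigcup_measurable.
by move=> _ [i [j [B [mB ->]]]] /=; exact: (mF i j).
Qed.

Lemma L2_integrable m n (F G : E -> 'M[R]_(m, n)) : L2 Omega F -> L2 Omega G ->
  leb.-integrable Omega (EFin \o (fun x => mxdot (F x) (G x))).
Proof.
move=> [mF iF] [mG iG].
apply: (le_integrable mO _ _ (integrableD mO iF iG)).
  by apply/measurable_EFinP; exact: measurable_fun_mxdot.
move=> x _ /=; rewrite lee_fin.
by rewrite [leRHS]ger0_norm ?addr_ge0 ?mxdot_ge0 ?mxdot_young.
Qed.

Lemma L2_lin m n a (F G : E -> 'M[R]_(m, n)) : L2 Omega F -> L2 Omega G ->
  L2 Omega (fun x => a *: F x + G x).
Proof.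
move=> LF LG; have [mF iF] := LF; have [mG iG] := LG; split.
  apply: measurable_fun_mx_on => i j.
  rewrite (_ : (fun x => _) = (fun x => a * F x i j + G x i j)); last first.
    by apply/funext => x; rewrite !mxE.
  apply: measurable_funD; last exact: measurable_fun_entry.
  by apply: measurable_funM => //; exact: measurable_fun_entry.
have i2 := integrableD mO (integrableZl mO (a ^+ 2) iF) (integrableD mO
   (integrableZl mO (2 * a) (L2_integrable LF LG)) iG).
apply: eq_integrable i2 => // x _ /=.
rewrite -!EFinM -!EFinD; congr EFin.
by rewrite !(mxdotDl, mxdotDr, mxdotZl, mxdotZr) (mxdotC (G x) (F x)); ring.
Qed.

Lemma L2_ext m n (F G : E -> 'M[R]_(m, n)) : F =1 G -> L2 Omega F -> L2 Omega G.
Proof. by move=> /funext ->. Qed.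

Lemma L2_sub m n (F G : E -> 'M[R]_(m, n)) : L2 Omega F -> L2 Omega G ->
  L2 Omega (fun x => F x - G x).
Proof.
move=> LF LG; apply: L2_ext (L2_lin (-1) LG LF) => x.
by rewrite scaleN1r addrC.
Qed.

Lemma L2ipC m n (F G : E -> 'M[R]_(m, n)) : L2ip Omega F G = L2ip Omega G F.
Proof. by apply: eq_Rintegral => x _; rewrite mxdotC. Qed.

Lemma L2ip_linl m n a (F G K : E -> 'M[R]_(m, n)) :
  L2 Omega F -> L2 Omega G -> L2 Omega K ->
  L2ip Omega (fun x => a *: F x + G x) K = a * L2ip Omega F K + L2ip Omega G K.
Proof.
move=> LF LG LK; rewrite /L2ip -RintegralZl//; last exact: L2_integrable.
rewrite -RintegralD//; [|exact: (integrableZl mO a (L2_integrable LF LK))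
                        |exact: L2_integrable].
by apply: eq_Rintegral => x _; rewrite mxdotDl mxdotZl.
Qed.

Lemma L2ip_subl m n (F G K : E -> 'M[R]_(m, n)) :
  L2 Omega F -> L2 Omega G -> L2 Omega K ->
  L2ip Omega (fun x => F x - G x) K = L2ip Omega F K - L2ip Omega G K.
Proof.
move=> LF LG LK; rewrite -[RHS]addrC -mulN1r -L2ip_linl//.
by apply: eq_Rintegral => x _; rewrite scaleN1r addrC.
Qed.

Lemma L2ip_subr m n (F G K : E -> 'M[R]_(m, n)) :
  L2 Omega F -> L2 Omega G -> L2 Omega K ->
  L2ip Omega K (fun x => F x - G x) = L2ip Omega K F - L2ip Omega K G.
Proof. by move=> LF LG LK; rewrite L2ipC L2ip_subl// !(L2ipC K). Qed.

Lemma L2ip_ge0 m n (F : E -> 'M[R]_(m, n)) : 0 <= L2ip Omega F F.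
Proof. by apply: Rintegral_ge0 => x _; exact: mxdot_ge0. Qed.

Lemma L2normE m n (F : E -> 'M[R]_(m, n)) : L2norm Omega F ^+ 2 = L2ip Omega F F.
Proof. by rewrite sqr_sqrtr// L2ip_ge0. Qed.

Lemma L2norm_ge0 m n (F : E -> 'M[R]_(m, n)) : 0 <= L2norm Omega F.
Proof. exact: sqrtr_ge0. Qed.

(** The squared norm of t F + G is a nonnegative quadratic polynomial in t. *)
Lemma L2ip_CS m n (F G : E -> 'M[R]_(m, n)) : L2 Omega F -> L2 Omega G ->
  L2ip Omega F G ^+ 2 <= L2ip Omega F F * L2ip Omega G G.
Proof.
move=> LF LG; apply: discriminant_le => [|t]; first exact: L2ip_ge0.
have := L2ip_ge0 (fun x => t *: F x + G x).
have LH := L2_lin t LF LG.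
rewrite L2ip_linl// (L2ipC F) L2ip_linl// (L2ipC G (fun x => t *: F x + G x)) L2ip_linl//.
by rewrite (L2ipC G F); set a := L2ip _ _ _; set b := L2ip _ _ _; set c := L2ip _ _ _; lra.
Qed.

End L2_theory.

(** * Functions of class C^k and test functions *)

Section Ck_theory.
Context {R : realType} (n : nat).
Implicit Types f g : 'rV[R]_n -> R.

Lemma CkW k f : Ck k.+1 f -> Ck k f.
Proof.
elim: k f => [|k IHk] f [cf df]; first by [].
split=> // i; have [df1 df2] := df i; split=> //; exact: IHk.
Qed.

Lemma partialD i f g : (forall x, derivable f x (delta_mx ord0 i)) ->
  (forall x, derivable g x (delta_mx ord0 i)) ->
  partial i (f \+ g) = partial i f \+ partial i g.
Proof. by move=> df dg; apply/funext => x; exact: deriveD. Qed.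

Lemma partialM i f g : (forall x, derivable f x (delta_mx ord0 i)) ->
  (forall x, derivable g x (delta_mx ord0 i)) ->
  partial i (f \* g) = (f \* partial i g) \+ (g \* partial i f).
Proof. by move=> df dg; apply/funext => x; exact: deriveM. Qed.

Lemma continuous_add f g : continuous f -> continuous g -> continuous (f \+ g).
Proof. by move=> cf cg x; exact: (cvgD (cf x) (cg x)). Qed.

Lemma continuous_mul f g : continuous f -> continuous g -> continuous (f \* g).
Proof. by move=> cf cg x; exact: (cvgM (cf x) (cg x)). Qed.

Lemma CkD k f g : Ck k f -> Ck k g -> Ck k (f \+ g).
Proof.
elim: k f g => [|k IHk] f g [cf df] [cg dg]; split; [exact: continuous_add|by []|exact: continuous_add|].
move=> i; have [df1 df2] := df i; have [dg1 dg2] := dg i; split.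
  by move=> x; exact: derivableD.
by rewrite partialD//; exact: IHk.
Qed.

Lemma CkM k f g : Ck k f -> Ck k g -> Ck k (f \* g).
Proof.
elim: k f g => [|k IHk] f g.
  by move=> [cf _] [cg _]; split => //; exact: continuous_mul.
move=> Cf Cg; have [cf df] := Cf; have [cg dg] := Cg.
split; first exact: continuous_mul.
move=> i; have [df1 df2] := df i; have [dg1 dg2] := dg i; split.
  by move=> x; exact: derivableM.
by rewrite partialM//; apply: CkD; apply: IHk => //; exact: CkW.
Qed.

Lemma Ck_cst k (a : R) : Ck k ((fun=> a) : 'rV[R]_n -> R).
Proof.
have ca b : continuous ((fun=> b) : 'rV[R]_n -> R) by exact: cst_continuous.
elim: k a => [|k IHk] a; split=> //.
move=> i; split; first by move=> x; exact: (derivable_cst a).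
rewrite (_ : partial _ _ = fun=> 0 : R); first exact: IHk.
by apply/funext => x; rewrite /partial derive_cst.
Qed.

Lemma smooth_derivable f i x : smooth f -> derivable f x (delta_mx ord0 i).
Proof. by move=> /(_ 1%N) [_ /(_ i)[]]. Qed.

Lemma smooth_partial f i : smooth f -> smooth (partial i f).
Proof. by move=> sf k; have [_ /(_ i)[]] := sf k.+1. Qed.

End Ck_theory.

Section test_fun_theory.
Context {R : realType} {n : nat} {Omega : set 'rV[R]_n}.
Implicit Types f g : 'rV[R]_n -> R.

Lemma test_funD f g : test_fun Omega f -> test_fun Omega g ->
  test_fun Omega (fun x => f x + g x).
Proof.
move=> [sf [K [cK KO fK]]] [sg [L [cL LO gL]]]; split.
  by move=> k; apply: CkD; [exact: sf|exact: sg].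
exists (K `|` L); split; [exact: compactU|by rewrite subUset|].
by move=> x /not_orP[Kx Lx]; rewrite fK// gL// addr0.
Qed.

Lemma test_funMl f g : smooth f -> test_fun Omega g ->
  test_fun Omega (fun x => f x * g x).
Proof.
move=> sf [sg [L [cL LO gL]]]; split.
  by move=> k; apply: CkM; [exact: sf|exact: sg].
by exists L; split=> // x Lx; rewrite gL// mulr0.
Qed.

Lemma test_funZ a g : test_fun Omega g -> test_fun Omega (fun x => a * g x).
Proof. by move=> tg; apply: (@test_funMl (fun=> a) g) tg => k; exact: Ck_cst. Qed.

(** Off a closed set a function that vanishes there vanishes near every point. *)
Lemma partial_eq0 (K : set 'rV[R]_n) f i : closed K ->
  (forall x, ~ K x -> f x = 0) -> forall x, ~ K x -> partial i f x = 0.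
Proof.
move=> cl fK x Kx; rewrite /partial.
have nx : \forall y \near x, f y = 0.
  have : nbhs x (~` K) by apply: open_nbhs_nbhs; split => //; exact: closed_openC.
  by apply: filterS => y; exact: fK.
by rewrite (@near_eq_derive _ _ _ f (cst 0)) ?derive_cst.
Qed.

Lemma compact_box (K : set 'rV[R]_n) : compact K ->
  exists M : R, forall (x : 'rV[R]_n) i, M < `|x ord0 i| -> ~ K x.
Proof.
move=> /compact_bounded[M [Mr KM]]; exists (`|M| + 1) => x i xi Kx.
have xM : `|x| <= `|M| + 1 by apply: KM => //; rewrite ltr_pwDr// ler_norm.
suff : `|x ord0 i| <= `|x|.
  by move=> h; have := lt_le_trans xi (le_trans h xM); rewrite ltxx.
rewrite [leRHS]/Num.Def.normr /= mx_normrE.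
exact: (le_bigmax _ (fun ij => `|x ij.1 ij.2|) (ord0, i)).
Qed.

Lemma test_fun_partial f i : test_fun Omega f -> test_fun Omega (partial i f).
Proof.
move=> tf; have [sf [K [cK KO fK]]] := tf; split; first exact: smooth_partial.
have cl : closed K by apply: compact_closed cK; exact: norm_hausdorff.
by exists K; split=> // x; exact: (partial_eq0 (K := K)).
Qed.

End test_fun_theory.

Section slices.
Context {R : realType} (n : nat).
Implicit Types f : 'rV[R]_n.+1 -> R.

Let quotient_tail f (a : R) (y : 'rV[R]_n) (j : 'I_n) :
  (fun h : R => h^-1 *: (((fun y => f (rV_cons (a, y))) \o shift y)
     (h *: delta_mx ord0 j) - f (rV_cons (a, y)))) =
  (fun h : R => h^-1 *: ((f \o shift (rV_cons (a, y)))
     (h *: delta_mx ord0 (lift ord0 j)) - f (rV_cons (a, y)))).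
Proof.
apply/funext => h; congr (_ *: (f _ - _)); apply/rowP => k; rewrite !mxE /=.
case: (unliftP ord0 k) => [l ->|->]; rewrite ?liftK ?unlift_none /= ?mxE ?eqxx /=.
  by rewrite (inj_eq lift_inj).
by rewrite mulr0 add0r.
Qed.

Let quotient_head f (a : R) (y : 'rV[R]_n) :
  (fun h : R => h^-1 *: (((fun t => f (rV_cons (t, y))) \o shift a)
     (h *: (1 : R)) - f (rV_cons (a, y)))) =
  (fun h : R => h^-1 *: ((f \o shift (rV_cons (a, y)))
     (h *: delta_mx ord0 ord0) - f (rV_cons (a, y)))).
Proof.
apply/funext => h; congr (_ *: (f _ - _)); apply/rowP => k; rewrite !mxE /=.
case: (unliftP ord0 k) => [l ->|->]; rewrite ?liftK ?unlift_none /= ?eqxx //=.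
by rewrite mulr0 add0r.
Qed.

(** Directional derivatives only see the restriction to a line, and the
lines parallel to the last axes stay in the slice where the first coordinate is [a]. *)
Lemma derivable_tail f a y j :
  derivable f (rV_cons (a, y)) (delta_mx ord0 (lift ord0 j)) ->
  derivable (fun y => f (rV_cons (a, y))) y (delta_mx ord0 j).
Proof. by rewrite /derivable -quotient_tail. Qed.

Lemma partial_tail f a y j :
  partial j (fun y => f (rV_cons (a, y))) y = partial (lift ord0 j) f (rV_cons (a, y)).
Proof. by rewrite /partial /derive quotient_tail. Qed.

Lemma derivable_head f a y :
  derivable f (rV_cons (a, y)) (delta_mx ord0 ord0) ->
  derivable (fun t => f (rV_cons (t, y))) a 1.
Proof. by rewrite /derivable -quotient_head. Qed.

Lemma derive_head f a y :
  'D_1 (fun t => f (rV_cons (t, y))) a = partial ord0 f (rV_cons (a, y)).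
Proof. by rewrite /partial /derive quotient_head. Qed.

Lemma continuous_rV_cons : continuous (fun p : R * 'rV[R]_n => rV_cons p).
Proof.
move=> p; apply/cvg_ballP => e e0.
near=> q; split=> // i j; rewrite !mxE.
case: (unliftP ord0 j) => [k _|_]; [have : ball p.2 e q.2|have : ball p.1 e q.1].
- by near: q; apply: (cvg_snd (nbhsx_ballx _ _ e0)).
- by move=> [_ h]; exact: h.
- by near: q; apply: (cvg_fst (nbhsx_ballx _ _ e0)).
- by [].
Unshelve. all: by end_near. Qed.

End slices.

(** * One-dimensional calculus and iterated integrals *)

Section calculus_1d.
Context {R : realType}.
Implicit Types (F : R -> R) (M t a b : R).
Local Notation mu := (@lebesgue_measure R).

Lemma integral_derive F a b : (forall t, derivable F t 1) -> continuous ('D_1 F) -> a < b ->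
  (\int[mu]_(t in `[a, b]) ('D_1 F t)%:E = (F b - F a)%:E)%E.
Proof.
move=> dF cF ab; have cF0 : continuous F.
  by move=> t; apply: differentiable_continuous; rewrite -derivable1_diffP.
rewrite EFinB; apply: continuous_FTC2 => //.
- exact: continuous_subspaceT.
- split=> [t _||]; [exact: dF|apply: cvg_at_right_filter|apply: cvg_at_left_filter];
    exact: cF0.
- by move=> t _; rewrite derive1E.
Qed.

(** Integrate over an interval that is longer than the support. *)
Lemma integral_derive_compact F M : (forall t, derivable F t 1) ->
  continuous ('D_1 F) -> (forall t, M < `|t| -> F t = 0) ->
  (forall t, M < `|t| -> 'D_1 F t = 0) ->
  (\int[mu]_t ('D_1 F t)%:E = 0)%E.
Proof.
move=> dF cF F0 DF0; pose N : R := `|M| + 1.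
have NM : M < N by rewrite /N (le_lt_trans (ler_norm M)) ?ltrDl.
have N0 : 0 < N by rewrite /N ltr_wpDl.
have -> : (\int[mu]_t ('D_1 F t)%:E = \int[mu]_(t in `[(- N)%R, N]) ('D_1 F t)%:E)%E.
  rewrite [RHS]integral_mkcond; apply: eq_integral => t _; rewrite patchE.
  case: ifPn => // /negP tN; rewrite DF0// (lt_le_trans NM)// leNgt.
  apply/negP; rewrite ltr_norml => /andP[t1 t2]; apply: tN.
  by rewrite inE /= in_itv /= !ltW.
rewrite integral_derive//; last by lra.
by rewrite !F0 ?subrr// ?normrN gtr0_norm.
Qed.

(** The square of F at x is the integral of 2 F F' up to x. It is the
one-dimensional inequality behind the L^4 bound. *)
Lemma sqr_le_integral_mul_derive F M : (forall t, derivable F t 1) ->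
  continuous ('D_1 F) -> (forall t, M < `|t| -> F t = 0) -> forall x,
  ((F x ^+ 2)%:E <= \int[mu]_t (2 * `|F t * 'D_1 F t|)%:E)%E.
Proof.
move=> dF cF F0 x; pose N : R := `|M| + `|x| + 1.
have cF0 : continuous F.
  by move=> t; apply: differentiable_continuous; rewrite -derivable1_diffP.
have Nx : - N < x.
  by rewrite /N; have := normr_ge0 M; have := ler_norm (- x); rewrite normrN; lra.
have FN : F (- N) = 0.
  apply: F0; rewrite normrN gtr0_norm /N.
    by have := ler_norm M; have := normr_ge0 x; lra.
  by have := normr_ge0 M; have := normr_ge0 x; lra.
have DE t : 'D_1 (F \* F) t = 2 * (F t * 'D_1 F t).
  rewrite deriveM//= /GRing.scale /=; ring.
have := @integral_derive (F \* F) (- N) x _ _ Nx; rewrite /= FN mulr0 subr0 -expr2 => <-.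
- apply: le_trans (lee_abs _) _.
  have m1 : measurable_fun setT (fun t => 'D_1 (F \* F) t).
    apply: continuous_measurable_fun => t.
    rewrite (_ : 'D_1 (F \* F) = fun t => 2 * (F t * 'D_1 F t)); last exact/funext.
    by apply: cvgM; [exact: cvg_cst|apply: cvgM; [exact: cF0|exact: cF]].
  apply: le_trans (le_abse_integral _ _ _) _ => //.
    exact/measurable_EFinP/measurable_funTS.
  apply: (@le_trans _ _ (\int[mu]_t `|('D_1 (F \* F) t)%:E|)%E).
    apply: ge0_subset_integral => //.
    by apply: measurableT_comp => //; exact/measurable_EFinP.
  by under eq_integral do rewrite abse_EFin DE normrM ger0_norm//.
- by move=> t; exact: derivableM.
- rewrite (_ : 'D_1 (F \* F) = fun t => 2 * (F t * 'D_1 F t)); last exact/funext.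
  by move=> t; apply: cvgM; [exact: cvg_cst|apply: cvgM; [exact: cF0|exact: cF]].
Qed.

End calculus_1d.

Section tonelli_rV.
Context {R : realType} (n : nat).
Local Notation leb := (@lebesgue_rV R).
Local Open Scope ereal_scope.

(** The structure [measurableTypeR R], on which Lebesgue measure lives, is
convertible to the one inferred for [R] but not syntactically equal to it. *)
Lemma measurable_rV_consT :
  measurable_fun [set: measurableTypeR R * 'rV[R]_n] (@rV_cons R n).
Proof. exact: measurable_rV_cons. Qed.

Lemma lebesgue_rV_pushforward : leb n.+1 =
  pushforward (@lebesgue_measure R \x leb n) (@rV_cons R n) :> (set _ -> \bar R).
Proof. by []. Qed.

Lemma ge0_integral_rV_cons (f : 'rV[R]_n.+1 -> \bar R) :
  measurable_fun setT f -> (forall x, 0 <= f x) ->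
  \int[leb n.+1]_x f x = \int[@lebesgue_measure R \x leb n]_p f (rV_cons p).
Proof.
move=> mf f0; rewrite lebesgue_rV_pushforward.
by rewrite (ge0_integral_pushforward measurable_rV_consT).
Qed.

Lemma tonelli_rV (f : 'rV[R]_n.+1 -> \bar R) :
  measurable_fun setT f -> (forall x, 0 <= f x) ->
  \int[leb n.+1]_x f x = \int[@lebesgue_measure R]_t \int[leb n]_y f (rV_cons (t, y)).
Proof.
move=> mf f0; rewrite ge0_integral_rV_cons//.
rewrite (fubini_tonelli1 (fun p : measurableTypeR R * 'rV[R]_n => f (rV_cons p)))//.
exact: (measurableT_comp mf measurable_rV_consT).
Qed.

Lemma tonelli_rV_swap (f : 'rV[R]_n.+1 -> \bar R) :
  measurable_fun setT f -> (forall x, 0 <= f x) ->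
  \int[leb n.+1]_x f x = \int[leb n]_y \int[@lebesgue_measure R]_t f (rV_cons (t, y)).
Proof.
move=> mf f0; rewrite ge0_integral_rV_cons//.
rewrite (fubini_tonelli2 (fun p : measurableTypeR R * 'rV[R]_n => f (rV_cons p)))//.
exact: (measurableT_comp mf measurable_rV_consT).
Qed.

Lemma integrable_rV_cons (f : 'rV[R]_n.+1 -> \bar R) :
  (leb n.+1).-integrable setT f ->
  (@lebesgue_measure R \x leb n).-integrable setT (fun p : measurableTypeR R * 'rV[R]_n => f (rV_cons p)).
Proof.
move=> /integrableP[mf lf]; apply/integrableP; split.
  exact: (measurableT_comp mf measurable_rV_consT).
rewrite -(ge0_integral_rV_cons (f := fun x => `|f x|))//.
exact: measurableT_comp.
Qed.

Lemma integral_rV_cons (f : 'rV[R]_n.+1 -> \bar R) :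
  (leb n.+1).-integrable setT f ->
  \int[leb n.+1]_x f x = \int[@lebesgue_measure R \x leb n]_p f (rV_cons p).
Proof.
move=> lf; rewrite lebesgue_rV_pushforward.
rewrite (integral_pushforward measurable_rV_consT)//.
  exact: measurable_int lf.
exact: integrable_rV_cons.
Qed.

Lemma Fubini_rV (f : 'rV[R]_n.+1 -> \bar R) :
  (leb n.+1).-integrable setT f ->
  \int[leb n.+1]_x f x = \int[@lebesgue_measure R]_t \int[leb n]_y f (rV_cons (t, y)).
Proof.
move=> lf; rewrite integral_rV_cons// -integral12_prod_meas1//.
exact: integrable_rV_cons.
Qed.

Lemma Fubini_rV_swap (f : 'rV[R]_n.+1 -> \bar R) :
  (leb n.+1).-integrable setT f ->
  \int[leb n.+1]_x f x = \int[leb n]_y \int[@lebesgue_measure R]_t f (rV_cons (t, y)).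
Proof.
move=> lf; rewrite integral_rV_cons// -integral21_prod_meas1//.
exact: integrable_rV_cons.
Qed.

Lemma measurable_rV_tail (f : 'rV[R]_n.+1 -> \bar R) t :
  measurable_fun setT f -> measurable_fun setT (fun y => f (rV_cons (t, y))).
Proof.
move=> mf; apply: (measurableT_comp mf).
exact: (measurableT_comp measurable_rV_consT (pair1_measurable t)).
Qed.

Lemma measurable_integral_tail (f : 'rV[R]_n.+1 -> \bar R) :
  measurable_fun setT f -> (forall x, 0 <= f x) ->
  measurable_fun setT (fun t => \int[leb n]_y f (rV_cons (t, y))).
Proof.
move=> mf f0.
apply: (measurable_fun_fubini_tonelli_F (fun p : measurableTypeR R * 'rV[R]_n => f (rV_cons p))) => //.
exact: (measurableT_comp mf measurable_rV_consT).
Qed.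

Lemma measurable_integral_head (f : 'rV[R]_n.+1 -> \bar R) :
  measurable_fun setT f -> (forall x, 0 <= f x) ->
  measurable_fun setT (fun y => \int[@lebesgue_measure R]_t f (rV_cons (t, y))).
Proof.
move=> mf f0.
apply: (measurable_fun_fubini_tonelli_G (fun p : measurableTypeR R * 'rV[R]_n => f (rV_cons p))) => //.
exact: (measurableT_comp mf measurable_rV_consT).
Qed.

End tonelli_rV.

(** * Compactly supported functions of class C^1 *)

Section compactly_supported.
Context {R : realType}.
Local Notation leb := (@lebesgue_rV R).

(** A box is used, and not a compact set, since boxes are stable under slicing. For
n = 0 there is no coordinate, and every function qualifies. *)
Definition box_supp n (M : R) (f : 'rV[R]_n -> R) :=
  forall (x : 'rV[R]_n) i, M < `|x ord0 i| -> f x = 0.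

Lemma box_supp_integrable n M (f : 'rV[R]_n -> R) : continuous f -> box_supp M f ->
  (leb n).-integrable setT (EFin \o f).
Proof.
move=> cf fM.
pose B := [set x : 'rV[R]_n | forall i, `[(- M), M]%classic (x ord0 i)].
have cB : compact B by apply: (@rV_compact _ _ (fun=> `[(- M), M]%classic)) => _; exact: segment_compact.
have mB : measurable B.
  rewrite (_ : B = \bigcap_(i in [set: 'I_n])
      ((fun x : 'rV[R]_n => x ord0 i) @^-1` `[(- M), M]%classic)).
    apply: fin_bigcap_measurable => // i _; rewrite -[X in measurable X]setTI.
    by apply: (measurable_mx_entry ord0 i measurableT); exact: measurable_itv.
  by apply/seteqP; split => [x Bx i _|x Bx i]; exact: Bx.
have fB x : ~ B x -> f x = 0.
  move=> /existsNP[i /negP xi]; apply: (fM x i).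
  by rewrite ltNge; apply: contra xi; rewrite ler_norml in_itv.
have lB : (leb n B < +oo)%E.
  rewrite /B (@lebesgue_rV_box _ _ (fun=> `[(- M), M]%classic)); last by move=> i; exact: measurable_itv.
  under eq_bigr do rewrite lebesgue_measure_itv.
  suff : (\prod_(i < n) (if (M%:E > (- M)%:E)%E then M%:E - (- M)%:E else 0)
      \is a fin_num)%E by move=> /fin_numP[_ h]; rewrite ltey.
  elim/big_ind : _ => // [a b|i _]; first exact: fin_numM.
  by case: ifP.
have /compact_bounded[K [_ KP]] : compact (f @` B).
  by apply: continuous_compact => //; exact: continuous_subspaceT.
have fK x : B x -> `|f x| <= `|K| + 1.
  by move=> Bx; apply: (KP (`|K| + 1)); [rewrite ltr_pwDr// ler_norm|exists x].
have mf : measurable_fun setT f by exact: continuous_measurable_mx.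
apply/integrableP; split; first exact/measurable_EFinP.
rewrite (_ : (\int[_]_(x in _) _)%E = (\int[leb n]_(x in B) `|(EFin \o f) x|)%E); last first.
  rewrite [RHS]integral_mkcond; apply: eq_integral => x _; rewrite patchE.
  by case: ifPn => // /negP; rewrite inE => /fB /= ->; rewrite normr0.
apply: (@le_lt_trans _ _ (\int[leb n]_(x in B) cst (`|K| + 1)%:E x)%E).
  apply: ge0_le_integral => //.
  by apply/measurableT_comp => //; apply/measurable_EFinP; exact: measurable_funTS.
by rewrite integral_cst// lte_mul_pinfty// ?lee_fin// addr_ge0.
Qed.

Lemma continuous_tail n (f : 'rV[R]_n.+1 -> R) t :
  continuous f -> continuous (fun y => f (rV_cons (t, y))).
Proof.
move=> cf y; apply: (@continuous_comp _ _ _ (fun y => rV_cons (t, y)) f); last exact: cf.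
apply: (@continuous_comp _ _ _ (fun y => (t, y)) (@rV_cons R n)).
  exact: (cvg_pair (@cst_continuous _ _ t y) (@cvg_id _ (nbhs y))).
exact: continuous_rV_cons.
Qed.

Lemma continuous_head n (f : 'rV[R]_n.+1 -> R) y :
  continuous f -> continuous (fun t => f (rV_cons (t, y))).
Proof.
move=> cf t; apply: (@continuous_comp _ _ _ (fun t => rV_cons (t, y)) f); last exact: cf.
apply: (@continuous_comp _ _ _ (fun t => (t, y)) (@rV_cons R n)).
  exact: (cvg_pair (@cvg_id _ (nbhs t)) (@cst_continuous _ _ y t)).
exact: continuous_rV_cons.
Qed.

Lemma box_supp_tail n M (f : 'rV[R]_n.+1 -> R) t :
  box_supp M f -> box_supp M (fun y => f (rV_cons (t, y))).
Proof. by move=> fM y i Mi; apply: (fM _ (lift ord0 i)); rewrite mxE liftK. Qed.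

Lemma box_supp_head n M (f : 'rV[R]_n.+1 -> R) y :
  box_supp M f -> forall t : R, M < `|t| -> f (rV_cons (t, y)) = 0.
Proof. by move=> fM t Mt; apply: (fM _ ord0); rewrite mxE unlift_none. Qed.

(** Carrying the support of the partial derivatives along makes the notion stable under
slicing by a mere computation on coordinates. *)
Record C1c n (M : R) (f : 'rV[R]_n -> R) : Prop := {
  C1c_Ck : Ck 1 f;
  C1c_supp : box_supp M f;
  C1c_supp_partial : forall i, box_supp M (partial i f) }.

Lemma C1c_cont n M (f : 'rV[R]_n -> R) : C1c M f -> continuous f.
Proof. by case=> -[]. Qed.

Lemma C1c_der n M (f : 'rV[R]_n -> R) i x :
  C1c M f -> derivable f x (delta_mx ord0 i).
Proof. by case=> -[_ /(_ i)[]]. Qed.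

Lemma C1c_cont_partial n M (f : 'rV[R]_n -> R) i : C1c M f -> continuous (partial i f).
Proof. by case=> -[_ /(_ i)[_ []]]. Qed.

Lemma C1c_tail n M (f : 'rV[R]_n.+1 -> R) t :
  C1c M f -> C1c M (fun y => f (rV_cons (t, y))).
Proof.
move=> fM; have pE i : partial i (fun y => f (rV_cons (t, y))) =
    fun y => partial (lift ord0 i) f (rV_cons (t, y)).
  by apply/funext => y; exact: partial_tail.
split.
- split; first exact: continuous_tail (C1c_cont fM).
  move=> i; split; first by move=> x; apply: derivable_tail; exact: C1c_der fM.
  by split=> //; rewrite pE; apply: continuous_tail; exact: C1c_cont_partial fM.
- exact: box_supp_tail (C1c_supp fM).
- by move=> i; rewrite pE; apply: box_supp_tail; exact: C1c_supp_partial fM _.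
Qed.

(** By Fubini the integral in the direction of derivation can be computed
first, where the fundamental theorem of calculus gives 0. *)
Lemma integral_partial n M (f : 'rV[R]_n -> R) i : C1c M f ->
  (\int[leb n]_x (partial i f x)%:E = 0)%E.
Proof.
elim: n i f => [[]//|n IHn] i f fM.
have If : (leb n.+1).-integrable setT (EFin \o partial i f).
  by apply: box_supp_integrable; [exact: C1c_cont_partial fM|exact: C1c_supp_partial fM _].
case: (unliftP ord0 i) => [j|] ei; rewrite ei in If *.
  rewrite (Fubini_rV If); apply: integral0_eq => t _ /=.
  under eq_integral do rewrite -partial_tail.
  exact/IHn/C1c_tail.
rewrite (Fubini_rV_swap If); apply: integral0_eq => y _ /=.
have DE : 'D_1 (fun t : R => f (rV_cons (t, y))) = fun t : R => partial ord0 f (rV_cons (t, y)).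
  by apply/funext => t; exact: derive_head.
under eq_integral do rewrite -derive_head.
apply: (@integral_derive_compact _ _ M).
- by move=> t; apply: derivable_head; exact: C1c_der fM.
- have : continuous (fun t : R => partial ord0 f (rV_cons (t, y))).
    by apply: continuous_head; exact: C1c_cont_partial fM.
  by rewrite -DE.
- exact: box_supp_head (C1c_supp fM).
- by move=> t Mt; rewrite derive_head; exact: box_supp_head (C1c_supp_partial fM _) _ Mt.
Qed.

Lemma sqr_le_integral_head n M (f : 'rV[R]_n.+1 -> R) t y : C1c M f ->
  ((f (rV_cons (t, y)) ^+ 2)%:E <= \int[@lebesgue_measure R]_s
    (2 * `|f (rV_cons (s, y)) * partial ord0 f (rV_cons (s, y))|)%:E)%E.
Proof.
move=> fM.
have DE : 'D_1 (fun t : R => f (rV_cons (t, y))) = fun t : R => partial ord0 f (rV_cons (t, y)).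
  by apply/funext => s; exact: derive_head.
under eq_integral do rewrite -derive_head.
apply: (@sqr_le_integral_mul_derive _ (fun t : R => f (rV_cons (t, y))) M).
- by move=> s; apply: derivable_head; exact: C1c_der fM.
- have : continuous (fun t : R => partial ord0 f (rV_cons (t, y))).
    by apply: continuous_head; exact: C1c_cont_partial fM.
  by rewrite -DE.
- exact: box_supp_head (C1c_supp fM).
Qed.

Lemma measurable_mul_partial n M (f : 'rV[R]_n -> R) i : C1c M f ->
  measurable_fun setT (fun x => (2 * `|f x * partial i f x|)%:E).
Proof.
move=> fM; apply/measurable_EFinP; apply: measurable_funM => //.
apply: measurableT_comp => //; apply: measurable_funM; apply: continuous_measurable_mx.
  exact: C1c_cont fM.
exact: C1c_cont_partial fM.
Qed.

(** The one-dimensional inequality on the space of row vectors of length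
1, which is a line times a point. *)
Lemma sqr_le_integral_rV1 M (f : 'rV[R]_1 -> R) x : C1c M f ->
  ((f x ^+ 2)%:E <= \int[leb 1]_y (2 * `|f y * partial ord0 f y|)%:E)%E.
Proof.
move=> fM; rewrite (tonelli_rV_swap (f := fun y => (2 * `|f y * partial ord0 f y|)%:E)).
- rewrite integral_dirac//; last first.
    apply: (measurable_integral_head (f := fun y => (2 * `|f y * partial ord0 f y|)%:E)).
      exact: measurable_mul_partial fM.
    by move=> y; rewrite lee_fin mulr_ge0.
  rewrite diracT mul1e -[x]rV_unconsK /rV_uncons.
  by rewrite (thinmx0 (\row_j _)); exact: sqr_le_integral_head fM.
- exact: measurable_mul_partial fM.
- by move=> y; rewrite lee_fin mulr_ge0.
Qed.

Let I n (h : 'rV[R]_n -> R) : \bar R := (\int[leb n]_x (h x)%:E)%E.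

(** Ladyzhenskaya's argument. The square of f at (t, y) is bounded by an integral over the
line through it in either direction, hence by a function of y alone and by a function of t
alone; bound one factor f^2 of f^4 by the former and the other by the latter. *)
Lemma ladyzhenskaya2 M (f : 'rV[R]_2 -> R) : C1c M f ->
  (I (fun x => f x ^+ 4)%R <= I (fun x => 2 * `|f x * partial ord0 f x|)%R *
     I (fun x => 2 * `|f x * partial (lift ord0 ord0) f x|)%R)%E.
Proof.
move=> fM.
pose g0 x := (2 * `|f x * partial ord0 f x|)%:E.
pose g1 x := (2 * `|f x * partial (lift ord0 ord0) f x|)%:E.
have mg0 : measurable_fun setT g0 by exact: measurable_mul_partial fM.
have mg1 : measurable_fun setT g1 by exact: measurable_mul_partial fM.
have g00 x : (0 <= g0 x)%E by rewrite lee_fin mulr_ge0.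
have g10 x : (0 <= g1 x)%E by rewrite lee_fin mulr_ge0.
pose H0 y := (\int[@lebesgue_measure R]_t g0 (rV_cons (t, y)))%E.
pose H1 t := (\int[leb 1]_y g1 (rV_cons (t, y)))%E.
have mH0 : measurable_fun setT H0 by exact: (measurable_integral_head mg0 g00).
have mH1 : measurable_fun setT H1 by exact: (measurable_integral_tail mg1 g10).
have H00 y : (0 <= H0 y)%E by apply: integral_ge0 => t _; exact: g00.
have H10 t : (0 <= H1 t)%E by apply: integral_ge0 => y _; exact: g10.
have mf : measurable_fun setT (fun x => (f x ^+ 4)%:E).
  apply/measurable_EFinP; apply: measurable_funX.
  by apply: continuous_measurable_mx; exact: C1c_cont fM.
rewrite /I (tonelli_rV mf); last by move=> x; rewrite lee_fin exprn_even_ge0.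
have E0 : (\int[leb 2]_x g0 x = \int[leb 1]_y H0 y)%E := tonelli_rV_swap mg0 g00.
have E1 : (\int[leb 2]_x g1 x = \int[@lebesgue_measure R]_t H1 t)%E := tonelli_rV mg1 g10.
rewrite -/(\int[leb 2]_x g0 x)%E -/(\int[leb 2]_x g1 x)%E E0 E1.
apply: (@le_trans _ _ (\int[@lebesgue_measure R]_t \int[leb 1]_y (H1 t * H0 y))%E).
  apply: ge0_le_integral => //.
  - by move=> t _; apply: integral_ge0 => y _; rewrite lee_fin exprn_even_ge0.
  - apply: (measurable_integral_tail mf) => x; by rewrite lee_fin exprn_even_ge0.
  - rewrite (_ : (fun t => _) = (fun t => H1 t * \int[leb 1]_y H0 y)%E).
      by apply: emeasurable_funM.
    by apply/funext => t; rewrite ge0_integralZl.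
  move=> t _; apply: ge0_le_integral => //.
  - by move=> y _; rewrite lee_fin exprn_even_ge0.
  - exact: (measurable_rV_tail t mf).
  - exact: measurable_funeM.
  (* f^4 = f^2 f^2, one factor for each direction *)
  move=> y _; rewrite (_ : (_ ^+ 4)%:E = (f (rV_cons (t, y)) ^+ 2)%:E *
     (f (rV_cons (t, y)) ^+ 2)%:E)%E; last by rewrite -EFinM; congr EFin; ring.
  apply: lee_pmul; rewrite ?lee_fin ?sqr_ge0//.
    rewrite /H1 /g1; under eq_integral do rewrite -partial_tail.
    apply: (@sqr_le_integral_rV1 M (fun y => f (rV_cons (t, y)))); exact: C1c_tail.
  exact: sqr_le_integral_head fM.
under eq_integral do rewrite ge0_integralZl//.
rewrite ge0_integralZr//; last exact: integral_ge0.
by rewrite muleC.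
Qed.

End compactly_supported.

(** * The L^4 bound in dimensions two and three *)

(** The final step on a slice: a and b are the two planar integrals of
|f f_i|, A is the squared L^2 norm of the slice, P and Q those of its derivatives. *)
Lemma mul_le_of_sqr_le (R : realFieldType) (a b A N P Q : R) :
  A <= N -> 0 <= P -> 0 <= Q -> a ^+ 2 <= A * P -> b ^+ 2 <= A * Q ->
  2 * a * (2 * b) <= 2 * N * (P + Q).
Proof.
move=> AN P0 Q0 aP bQ.
have h1 := ler_wpM2r P0 AN; have h2 := ler_wpM2r Q0 AN.
by have := sqr_ge0 (a - b); lra.
Qed.

Section ladyzhenskaya.
Context {R : realType}.
Local Notation leb := (@lebesgue_rV R).

Lemma integral_EFin_fine n (h : 'rV[R]_n -> R) :
  (leb n).-integrable setT (EFin \o h) ->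
  (\int[leb n]_x (h x)%:E)%E = (\int[leb n]_x h x)%:E.
Proof. by move=> ih; rewrite fineK//; exact: integrable_fin_num. Qed.

Lemma continuous_sqr n (f : 'rV[R]_n -> R) :
  continuous f -> continuous (fun x => f x ^+ 2).
Proof.
move=> cf; rewrite (_ : (fun x => _) = f \* f); last by apply/funext => x; rewrite expr2.
exact: continuous_mul.
Qed.

Lemma box_suppM n M (f g : 'rV[R]_n -> R) : box_supp M f -> box_supp M (fun x => f x * g x).
Proof. by move=> fM x i xi; rewrite (fM x i)// mul0r. Qed.

Lemma box_supp_sqr n M (f : 'rV[R]_n -> R) : box_supp M f -> box_supp M (fun x => f x ^+ 2).
Proof. by move=> fM x i xi; rewrite (fM x i)// expr0n. Qed.

Lemma continuous_norm n (f : 'rV[R]_n -> R) :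
  continuous f -> continuous (fun x => `|f x|).
Proof. by move=> cf x; exact: (cvg_norm (cf x)). Qed.

Lemma box_supp_norm n M (f : 'rV[R]_n -> R) : box_supp M f -> box_supp M (fun x => `|f x|).
Proof. by move=> fM x i xi; rewrite (fM x i)// normr0. Qed.

(** Cauchy-Schwarz for scalars, read off from 1 x 1 matrices. *)
Lemma box_supp_CS n M (f g : 'rV[R]_n -> R) : continuous f -> continuous g ->
  box_supp M f -> box_supp M g ->
  (\int[leb n]_x `|f x * g x|) ^+ 2 <=
  (\int[leb n]_x f x ^+ 2) * (\int[leb n]_x g x ^+ 2).
Proof.
move=> cf cg fM gM; pose w (h : 'rV[R]_n -> R) x : 'M[R]_1 := const_mx `|h x|.
have wE h k x : mxdot (w h x) (w k x) = `|h x * k x|.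
  by rewrite /mxdot !big_ord1 !mxE normrM.
have wL h : continuous h -> box_supp M h -> L2 setT (w h).
  move=> ch hM; split.
    apply: measurable_fun_mx => i j.
    rewrite (_ : (fun x => _) = (fun x => `|h x|)); last by apply/funext => x; rewrite mxE.
    by apply: continuous_measurable_mx; exact: continuous_norm.
  under eq_fun do rewrite wE.
  apply: (@box_supp_integrable _ _ M); first exact/continuous_norm/continuous_mul.
  by apply: box_supp_norm; exact: box_suppM.
have := L2ip_CS measurableT (wL _ cf fM) (wL _ cg gM).
rewrite /L2ip.
under eq_Rintegral do rewrite wE.
under [X in _ <= X * _]eq_Rintegral do rewrite wE -expr2 ger0_norm ?sqr_ge0//.
by under [X in _ <= _ * X]eq_Rintegral do rewrite wE -expr2 ger0_norm ?sqr_ge0//.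
Qed.

(** The square of the H^1 norm of a scalar function on the whole space. *)
Definition energy n (f : 'rV[R]_n -> R) : R :=
  \int[leb n]_x (f x ^+ 2 + \sum_i partial i f x ^+ 2).

Lemma energy_integrable n M (f : 'rV[R]_n -> R) : C1c M f ->
  (leb n).-integrable setT
    (EFin \o (fun x => f x ^+ 2 + \sum_i partial i f x ^+ 2)).
Proof.
move=> fM; apply: (@box_supp_integrable _ _ M).
  apply: continuous_add; first exact: continuous_sqr (C1c_cont fM).
  rewrite (_ : (fun x => _) = \sum_i (fun x => partial i f x ^+ 2)); last first.
    by apply/funext => x; rewrite fct_sumE.
  elim/big_ind : _ => [|g h cg ch|i _]; first exact: cst_continuous.
    exact: continuous_add.
  exact: continuous_sqr (C1c_cont_partial fM).
move=> x i xi; rewrite (C1c_supp fM xi) expr0n add0r.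
by rewrite big1// => j _; rewrite (C1c_supp_partial fM j xi) expr0n.
Qed.

Lemma energy_ge0 n (f : 'rV[R]_n -> R) : 0 <= energy f.
Proof.
by apply: Rintegral_ge0 => x _; rewrite addr_ge0 ?sqr_ge0// sumr_ge0// => i _; rewrite sqr_ge0.
Qed.

Lemma integral_mul_partial_le_energy n M (f : 'rV[R]_n -> R) i : C1c M f ->
  (\int[leb n]_x (2 * `|f x * partial i f x|)%:E <= (energy f)%:E)%E.
Proof.
move=> fM; rewrite /energy -integral_EFin_fine; last exact: energy_integrable fM.
apply: ge0_le_integral => //.
- exact: measurable_mul_partial fM.
- exact: measurable_int (energy_integrable fM).
move=> x _; rewrite lee_fin (bigD1 i)//= addrA.
apply: (@le_trans _ _ (f x ^+ 2 + partial i f x ^+ 2)); last first.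
  by rewrite lerDl sumr_ge0// => j _; rewrite sqr_ge0.
rewrite normrM -(real_normK (num_real (f x))) -(real_normK (num_real (partial i f x))).
by have := sqr_ge0 (`|f x| - `|partial i f x|); lra.
Qed.

Lemma integral_pow4_le_energy2 M (f : 'rV[R]_2 -> R) : C1c M f ->
  (\int[leb 2]_x (f x ^+ 4)%:E <= (2 * energy f ^+ 2)%:E)%E.
Proof.
move=> fM; apply: le_trans (ladyzhenskaya2 fM) _.
apply: (@le_trans _ _ ((energy f)%:E * (energy f)%:E)%E); last first.
  by rewrite -EFinM lee_fin -expr2 ler_peMl ?sqr_ge0// ler1n.
apply: lee_pmul; try exact: (integral_mul_partial_le_energy _ fM);
  by apply: integral_ge0 => x _; rewrite lee_fin mulr_ge0.
Qed.

(** On the slice x_0 = t the planar inequality and Cauchy-Schwarz bound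
the integral of f^4 by 2 A(t) (P_1(t) + P_2(t)), where A(t) is the squared L^2 norm of the
slice and P_i(t) those of its derivatives. The one-dimensional inequality in the direction x_0
bounds A(t) by the energy for all t, and P_1 + P_2 integrates to at most the energy. *)
Lemma integral_pow4_le_energy3 M (f : 'rV[R]_3 -> R) : C1c M f ->
  (\int[leb 3]_x (f x ^+ 4)%:E <= (2 * energy f ^+ 2)%:E)%E.
Proof.
move=> fM.
pose i1 : 'I_2 := ord0; pose i2 : 'I_2 := lift ord0 ord0.
(* i1 and i2 are the directions of the slice; q is the part of the energy
   that integrates P_1 + P_2 *)
pose q x := partial (lift ord0 i1) f x ^+ 2 + partial (lift ord0 i2) f x ^+ 2.
have cq : continuous q by apply: continuous_add; exact: continuous_sqr (C1c_cont_partial fM).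
have qM : box_supp M q.
  by move=> x i xi; rewrite /q !(C1c_supp_partial fM _ xi) expr0n addr0.
have q0 x : 0 <= q x by rewrite addr_ge0 ?sqr_ge0.
have iq : (leb 3).-integrable setT (EFin \o q) by exact: box_supp_integrable qM.
have mq := measurable_int _ iq.
have mf : measurable_fun setT (fun x => (f x ^+ 4)%:E).
  apply/measurable_EFinP; apply: measurable_funX.
  by apply: continuous_measurable_mx; exact: C1c_cont fM.
have f0 x : (0 <= (f x ^+ 4)%:E)%E by rewrite lee_fin exprn_even_ge0.
have N0 := energy_ge0 f.
rewrite (tonelli_rV mf f0).
apply: (@le_trans _ _ (\int[@lebesgue_measure R]_t
    ((2 * energy f)%:E * \int[leb 2]_y (q (rV_cons (t, y)))%:E))%E).
  apply: ge0_le_integral => //.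
  - by move=> t _; apply: integral_ge0 => y _; exact: f0.
  - exact: (measurable_integral_tail mf f0).
  - by apply: measurable_funeM; exact: (measurable_integral_tail mq).
  move=> t _.
  have gM := C1c_tail t fM; set g := (fun y => _) in gM.
  apply: le_trans (ladyzhenskaya2 gM) _.
  pose P i := \int[leb 2]_y partial i g y ^+ 2.
  pose A := \int[leb 2]_y g y ^+ 2.
  have P0 i : 0 <= P i by apply: Rintegral_ge0 => y _; rewrite sqr_ge0.
  have ig i : (leb 2).-integrable setT (EFin \o (fun y => partial i g y ^+ 2)).
    apply: (@box_supp_integrable _ _ M); first exact: continuous_sqr (C1c_cont_partial gM).
    exact: box_supp_sqr (C1c_supp_partial gM _).
  have igg : (leb 2).-integrable setT (EFin \o (fun y => g y ^+ 2)).
    apply: (@box_supp_integrable _ _ M); first exact: continuous_sqr (C1c_cont gM).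
    exact: box_supp_sqr (C1c_supp gM).
  have qE : (\int[leb 2]_y (q (rV_cons (t, y)))%:E)%E = (P i1 + P i2)%:E.
    rewrite /P -RintegralD// -integral_EFin_fine; last first.
      by have := integrableD measurableT (ig i1) (ig i2).
    by apply: eq_integral => y _; rewrite /q -!partial_tail.
  (* f^2 at (t, y) is at most the integral of 2 |f f_0| over the line through
     that point, which does not depend on t *)
  have AN : A <= energy f.
    rewrite -lee_fin -integral_EFin_fine//.
    apply: le_trans (integral_mul_partial_le_energy ord0 fM).
    rewrite (tonelli_rV_swap (measurable_mul_partial _ fM)); last by move=> x; rewrite lee_fin mulr_ge0.
    apply: ge0_le_integral => //.
    - by move=> y _; rewrite lee_fin sqr_ge0.
    - exact: measurable_int igg.
    - apply: (measurable_integral_head (measurable_mul_partial _ fM)) => x.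
      by rewrite lee_fin mulr_ge0.
    - by move=> y _; exact: sqr_le_integral_head fM.
  have ia i : (leb 2).-integrable setT (EFin \o (fun y => `|g y * partial i g y|)).
    apply: (@box_supp_integrable _ _ M).
      exact: continuous_norm (continuous_mul (C1c_cont gM) (C1c_cont_partial gM)).
    by apply: box_supp_norm; apply: box_suppM; exact: C1c_supp gM.
  pose a i := \int[leb 2]_y `|g y * partial i g y|.
  have aE i : (\int[leb 2]_y (2 * `|g y * partial i g y|)%:E)%E = (2 * a i)%:E.
    rewrite /a -RintegralZl// -integral_EFin_fine//.
    by have := integrableZl measurableT 2 (ia i).
  have aP i : a i ^+ 2 <= A * P i.
    apply: (box_supp_CS (C1c_cont gM) (C1c_cont_partial gM) (C1c_supp gM) (C1c_supp_partial gM _)).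
  have key (X1 X2 Y : \bar R) : X1 = (2 * a i1)%:E -> X2 = (2 * a i2)%:E ->
      Y = (P i1 + P i2)%:E -> (X1 * X2 <= (2 * energy f)%:E * Y)%E.
    move=> -> -> ->; rewrite -!EFinM lee_fin.
    exact: (mul_le_of_sqr_le AN (P0 i1) (P0 i2)).
  apply: key; [exact: (aE i1)|exact: (aE i2)|exact: qE].
rewrite ge0_integralZl//; last 3 first.
- exact: (measurable_integral_tail mq).
- by move=> t _; apply: integral_ge0 => y _; rewrite lee_fin.
- by rewrite lee_fin mulr_ge0.
rewrite -(tonelli_rV mq) ?[X in (_ * X)%E](integral_EFin_fine iq)//.
rewrite -EFinM lee_fin expr2 mulrA ler_wpM2l ?mulr_ge0//.
apply: le_Rintegral => //; first exact: energy_integrable fM.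
move=> x _; rewrite /q 2!big_ord_recl big_ord1.
by have := sqr_ge0 (f x); have := sqr_ge0 (partial ord0 f x); lra.
Qed.

Lemma integral_pow4_le_energy n M (f : 'rV[R]_n -> R) : n = 2%N \/ n = 3%N -> C1c M f ->
  (\int[leb n]_x (f x ^+ 4)%:E <= (2 * energy f ^+ 2)%:E)%E.
Proof. by move=> nE; case: nE f => -> f; [exact: integral_pow4_le_energy2|exact: integral_pow4_le_energy3]. Qed.

End ladyzhenskaya.

(** * Elementary inequalities and test vector fields *)

(** With a = |v|^2, b = |phi|^2 and c = |v - phi|^2: either a is comparable to b,
or it is comparable to c. The truncation of one factor a at m makes the second case linear in
c, hence small when phi approximates v in L^2. *)
Lemma truncated_sqr_le (R : realFieldType) (a b c m : R) :
  0 <= a -> 0 <= b -> 0 <= c -> 0 <= m -> a <= 2 * b + 2 * c ->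
  Num.min a m * a <= 16 * b ^+ 2 + 4 * m * c.
Proof.
move=> a0 b0 c0 m0 abc.
have [ab|ba] := leP a (4 * b).
  apply: (@le_trans _ _ (a * a)); first by rewrite ler_wpM2r// ge_min lexx.
  have h : a * a <= (4 * b) * (4 * b) by rewrite ler_pM.
  have h' : 0 <= m * c by rewrite mulr_ge0.
  by move: h h'; lra.
have ac : a <= 4 * c by lra.
apply: (@le_trans _ _ (m * a)); first by rewrite ler_wpM2r// ge_min lexx orbT.
have h : m * a <= m * (4 * c) by rewrite ler_wpM2l.
by have := sqr_ge0 b; move: h; lra.
Qed.

(** Cauchy-Schwarz, from 2 a_i a_j <= a_i^2 + a_j^2. *)
Lemma sqr_sum_le (R : realFieldType) n (a : 'I_n -> R) :
  (\sum_i a i) ^+ 2 <= n%:R * \sum_i a i ^+ 2.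
Proof.
have -> : n%:R * \sum_i a i ^+ 2 = \sum_i \sum_j ((a i ^+ 2 + a j ^+ 2) / 2).
  under [RHS]eq_bigr do rewrite -mulr_suml big_split /= sumr_const card_ord.
  rewrite -mulr_suml big_split /= sumr_const card_ord sumrMnl.
  by set S := \sum_i _; rewrite -[S *+ n]mulr_natl; field.
rewrite expr2 mulr_suml ler_sum// => i _; rewrite mulr_sumr ler_sum// => j _.
by have := sqr_ge0 (a i - a j); lra.
Qed.

Lemma le_of_le_addM (R : realFieldType) (x y : R) (K : R) : 0 <= K ->
  (forall e, 0 < e -> e <= 1 -> x <= y + K * e) -> x <= y.
Proof.
move=> K0 h; rewrite leNgt; apply/negP => yx.
(* small enough for K e to be at most half of x - y *)
pose e := Num.min 1 ((x - y) / (2 * (K + 1))).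
have e0 : 0 < e.
  rewrite lt_min ltr01/= divr_gt0 ?subr_gt0// mulr_gt0// ltr_wpDl//.
have e1 : e <= 1 by rewrite ge_min lexx.
have := h e e0 e1; rewrite leNgt => /negP; apply.
have e2 : e <= (x - y) / (2 * (K + 1)) by rewrite ge_min lexx orbT.
have Ke : K * e <= (x - y) / 2.
  apply: (@le_trans _ _ ((K + 1) * e)); first by rewrite ler_wpM2r ?lerDl// ltW.
  apply: (@le_trans _ _ ((K + 1) * ((x - y) / (2 * (K + 1))))).
    by rewrite ler_wpM2l// addr_ge0.
  rewrite le_eqVlt; apply/orP; left; apply/eqP; field.
  by rewrite gt_eqF// ltr_wpDl.
by move: Ke yx; lra.
Qed.

Section test_fields.
Context {R : realType} {d : nat} {Omega : set 'rV[R]_d}.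
Hypothesis oO : open Omega.
Local Notation E := 'rV[R]_d.
Local Notation leb := (@lebesgue_rV R d).

Let mO : measurable Omega := open_measurable_mx oO.

Lemma test_fun_C1c (f : E -> R) : test_fun Omega f -> exists M, C1c M f.
Proof.
move=> [sf [K [cK KO fK]]]; have [M KM] := compact_box cK.
have cl : closed K by apply: compact_closed cK; exact: norm_hausdorff.
exists M; split; first exact: sf.
  by move=> x i /KM; exact: fK.
by move=> i x j /KM; exact: partial_eq0.
Qed.

Lemma test_fun_off (f : E -> R) x : test_fun Omega f -> ~ Omega x ->
  f x = 0 /\ forall i, partial i f x = 0.
Proof.
move=> [sf [K [cK KO fK]]] Ox.
have cl : closed K by apply: compact_closed cK; exact: norm_hausdorff.
have Kx : ~ K x by move=> /KO.
split=> [|i]; first exact: fK.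
by apply: (partial_eq0 (K := K)).
Qed.

Lemma test_fun_integrable_sqr (f : E -> R) : test_fun Omega f ->
  leb.-integrable Omega (EFin \o (fun x => f x ^+ 2)).
Proof.
move=> /test_fun_C1c[M fM]; apply: (@integrableS _ _ _ _ setT) => //.
apply: (@box_supp_integrable _ _ M); first exact: continuous_sqr (C1c_cont fM).
exact: box_supp_sqr (C1c_supp fM).
Qed.

Lemma test_fun_integrable_partial_sqr (f : E -> R) i : test_fun Omega f ->
  leb.-integrable Omega (EFin \o (fun x => partial i f x ^+ 2)).
Proof.
move=> /test_fun_C1c[M fM]; apply: (@integrableS _ _ _ _ setT) => //.
apply: (@box_supp_integrable _ _ M); first exact: continuous_sqr (C1c_cont_partial fM).
exact: box_supp_sqr (C1c_supp_partial fM _).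
Qed.

Definition test_field (phi : E -> 'rV[R]_d) :=
  forall j, test_fun Omega (fun x => phi x ord0 j).

Lemma integrable_mxdot_entries m n (F : E -> 'M[R]_(m, n)) :
  (forall i j, leb.-integrable Omega (EFin \o (fun x => F x i j ^+ 2))) ->
  leb.-integrable Omega (fun x => (mxdot (F x) (F x))%:E).
Proof.
move=> iF.
apply: (eq_integrable mO (fun x => \sum_i \sum_j (F x i j ^+ 2)%:E)%E).
  move=> x _; rewrite /mxdot -sumEFin; apply: eq_bigr => i _.
  by rewrite -sumEFin; apply: eq_bigr => j _; rewrite expr2.
by apply: integrable_sum => // i _; apply: integrable_sum => // j _; exact: iF.
Qed.

Lemma test_field_L2 phi : test_field phi -> L2 Omega phi.
Proof.
move=> tphi; split.
  apply: measurable_funTS; apply: measurable_fun_mx => i j; rewrite ord1.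
  have [M fM] := test_fun_C1c (tphi j).
  by apply: continuous_measurable_mx; exact: C1c_cont fM.
apply: integrable_mxdot_entries => i j; rewrite ord1.
exact: test_fun_integrable_sqr (tphi j).
Qed.

Lemma test_field_gradient_L2 phi : test_field phi -> L2 Omega (gradient phi).
Proof.
move=> tphi; have pE i j : (fun x => gradient phi x i j) = partial i (fun x => phi x ord0 j).
  by apply/funext => x; rewrite mxE.
split.
  apply: measurable_funTS; apply: measurable_fun_mx => i j; rewrite pE.
  have [M fM] := test_fun_C1c (tphi j).
  by apply: continuous_measurable_mx; exact: C1c_cont_partial fM.
apply: integrable_mxdot_entries => i j.
rewrite (_ : (fun x => _) = (fun x => partial i (fun x => phi x ord0 j) x ^+ 2)).
  exact: test_fun_integrable_partial_sqr (tphi j).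
by apply/funext => x; rewrite mxE.
Qed.

Lemma test_field_lin a phi psi : test_field phi -> test_field psi ->
  test_field (fun x => a *: phi x + psi x).
Proof.
move=> tphi tpsi j; rewrite (_ : (fun x => _) = (fun x => a * phi x ord0 j + psi x ord0 j)).
  by apply: test_funD => //; exact: test_funZ.
by apply/funext => x; rewrite !mxE.
Qed.

Lemma gradient_lin a phi psi : test_field phi -> test_field psi -> forall x,
  gradient (fun x => a *: phi x + psi x) x = a *: gradient phi x + gradient psi x.
Proof.
move=> tphi tpsi x; apply/matrixP => i j; rewrite !mxE.
have d1 : derivable (fun x => phi x ord0 j) x (delta_mx ord0 i).
  by apply: smooth_derivable; case: (tphi j).
have d2 : derivable (fun x => psi x ord0 j) x (delta_mx ord0 i).
  by apply: smooth_derivable; case: (tpsi j).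
rewrite /partial (_ : (fun y => _) = (a \*: (fun x => phi x ord0 j)) \+ (fun x => psi x ord0 j)).
  by rewrite (deriveD (derivableZ (k := a) d1) d2) (deriveZ a d1).
by apply/funext => y; rewrite !mxE.
Qed.

(** The square of [H1norm], for which no square root has to be handled. *)
Definition H1sq (F : E -> 'rV[R]_d) (DF : E -> 'M[R]_d) : R :=
  L2ip Omega F F + L2ip Omega DF DF.

Lemma H1sq_ge0 F DF : 0 <= H1sq F DF.
Proof. by rewrite addr_ge0// L2ip_ge0. Qed.

(** The energy is an integral over the whole space, where a test function and its
derivatives vanish outside Omega. *)
Lemma energy_le_H1sq phi j : test_field phi ->
  energy (fun x => phi x ord0 j) <= H1sq phi (gradient phi).
Proof.
move=> tphi; have [M fM] := test_fun_C1c (tphi j).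
have [_ i1] := test_field_L2 tphi; have [_ i2] := test_field_gradient_L2 tphi.
rewrite /H1sq /L2ip -RintegralD//.
have ie := energy_integrable fM.
rewrite /energy [leLHS](_ : _ = \int[leb]_(x in Omega) (phi x ord0 j ^+ 2 +
    \sum_i partial i (fun x => phi x ord0 j) x ^+ 2)); last first.
  rewrite [RHS]Rintegral_mkcond; apply: eq_Rintegral => x _; rewrite patchE.
  case: ifPn => // /negP; rewrite inE => /(test_fun_off (tphi j))[-> h].
  by rewrite expr0n add0r big1// => i _; rewrite h expr0n.
apply: le_Rintegral => //.
- exact: integrableS ie.
- exact: (integrableD mO i1 i2).
move=> x _; apply: lerD.
  rewrite /mxdot big_ord1 (bigD1 j)//= -expr2 lerDl sumr_ge0// => k _.
  by rewrite -expr2 sqr_ge0.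
rewrite /mxdot ler_sum// => i _.
rewrite (bigD1 j)//= !mxE -expr2 lerDl sumr_ge0// => k _.
by rewrite -expr2 sqr_ge0.
Qed.

Lemma test_field_L4 phi : d = 2%N \/ d = 3%N -> test_field phi ->
  (\int[leb]_(x in Omega) ((mxdot (phi x) (phi x)) ^+ 2)%:E <=
   (2 * d%:R ^+ 2 * H1sq phi (gradient phi) ^+ 2)%:E)%E.
Proof.
move=> d23 tphi.
have mphi j : measurable_fun setT (fun x => phi x ord0 j).
  have [M fM] := test_fun_C1c (tphi j).
  by apply: continuous_measurable_mx; exact: C1c_cont fM.
have mphi4 j : measurable_fun setT (fun x => (phi x ord0 j ^+ 4)%:E).
  by apply/measurable_EFinP; exact: measurable_funX.
have [mF _] := test_field_L2 tphi.
apply: (@le_trans _ _ (\int[leb]_(x in Omega)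
    (d%:R%:E * \sum_j (phi x ord0 j ^+ 4)%:E))%E).
  apply: ge0_le_integral => //.
  - by move=> x _; rewrite lee_fin sqr_ge0.
  - by apply/measurable_EFinP; apply: measurable_funX; exact: measurable_fun_mxdot.
  - apply: measurable_funeM; apply: measurable_funTS.
    by apply: emeasurable_sum => j; exact: mphi4.
  move=> x _; rewrite sumEFin -EFinM lee_fin /mxdot big_ord1.
  under eq_bigr do rewrite -expr2.
  apply: le_trans (sqr_sum_le _) _; rewrite ler_wpM2l// ler_sum// => j _.
  by rewrite -exprM.
rewrite ge0_integralZl//; last 2 first.
- by apply: measurable_funTS; apply: emeasurable_sum => j; exact: mphi4.
- by move=> x _; apply: sume_ge0 => j _; rewrite lee_fin exprn_even_ge0.
rewrite ge0_integral_sum//; last 2 first.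
- by move=> j; exact: measurable_funTS (mphi4 j).
- by move=> j x _; rewrite lee_fin exprn_even_ge0.
apply: (@le_trans _ _ (d%:R%:E * \sum_(j < d) (2 * H1sq phi (gradient phi) ^+ 2)%:E)%E).
  apply: lee_wpmul2l; first by rewrite lee_fin.
  apply: lee_sum => j _; have [M fM] := test_fun_C1c (tphi j).
  apply: (@le_trans _ _ (\int[leb]_x (phi x ord0 j ^+ 4)%:E)%E).
    by apply: ge0_subset_integral => // x _; rewrite lee_fin exprn_even_ge0.
  apply: le_trans (integral_pow4_le_energy d23 fM) _; rewrite lee_fin ler_wpM2l//.
  by rewrite ler_sqr ?nnegrE ?energy_ge0 ?H1sq_ge0// energy_le_H1sq.
rewrite sumEFin -EFinM lee_fin sumr_const card_ord -[_ *+ d]mulr_natl.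
by rewrite le_eqVlt; apply/orP; left; apply/eqP; ring.
Qed.

End test_fields.

(** * The L^4 bound on H^1_0 *)

Section H1_0_theory.
Context {R : realType} {d : nat} {Omega : set 'rV[R]_d}.
Hypothesis oO : open Omega.
Hypothesis d23 : d = 2%N \/ d = 3%N.
Local Notation E := 'rV[R]_d.
Local Notation leb := (@lebesgue_rV R d).
Local Notation sqH1 := (@H1sq R d Omega).
Local Notation test_field := (@test_field R d Omega).

Let mO : measurable Omega := open_measurable_mx oO.

(** Membership in H^1_0, for a pair of a field and its gradient that need not come from a
record [H1], so that differences with test fields are covered. *)
Definition H1_0 (F : E -> 'rV[R]_d) (DF : E -> 'M[R]_d) :=
  [/\ L2 Omega F, L2 Omega DF & forall eta, 0 < eta -> exists2 phi, test_field phi &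
    sqH1 (fun x => F x - phi x) (fun x => DF x - gradient phi x) < eta].

(** The squared norm form of the triangle inequality, which suffices for
every limit taken below. *)
Lemma L2ip_triangle m n (F G : E -> 'M[R]_(m, n)) : L2 Omega F -> L2 Omega G ->
  L2ip Omega G G <= 2 * L2ip Omega F F +
    2 * L2ip Omega (fun x => F x - G x) (fun x => F x - G x).
Proof.
move=> LF LG; have LH := L2_sub mO LF LG.
have iF := L2_integrable mO LF LF; have iH := L2_integrable mO LH LH.
have iF2 := integrableZl mO 2 iF; have iH2 := integrableZl mO 2 iH.
rewrite /L2ip -(RintegralZl _ mO iF) -(RintegralZl _ mO iH) -RintegralD//.
apply: le_Rintegral => //; first exact: L2_integrable.
  exact: (integrableD mO iF2 iH2).
move=> x _; set A := F x; set B := G x.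
have := mxdot_ge0 (2 *: A + (-1) *: B).
rewrite -[- B]scaleN1r !(mxdotDl, mxdotDr, mxdotZl, mxdotZr) (mxdotC B A).
by move=> h; have := mxdot_ge0 A; move: h; lra.
Qed.

Lemma H1sq_triangle F DF phi : L2 Omega F -> L2 Omega DF -> test_field phi ->
  sqH1 phi (gradient phi) <= 2 * sqH1 F DF +
    2 * sqH1 (fun x => F x - phi x) (fun x => DF x - gradient phi x).
Proof.
move=> LF LDF tphi.
have := L2ip_triangle LF (test_field_L2 oO tphi).
have := L2ip_triangle LDF (test_field_gradient_L2 oO tphi).
by rewrite /H1sq => h1 h2; lra.
Qed.

(** The bound of the L^4 norm passes from test fields to their limits in H^1.
As L^2 convergence does not control fourth powers, one of the two factors |F|^2 is truncated at
height m: the truncated integral is bounded by the fourth powers of an approximating test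
field up to an arbitrarily small error, for each m, and m tends to infinity by monotone
convergence. The constant is 16 from [truncated_sqr_le], 2 d^2 from [test_field_L4], and 4^2
as the approximating field has [H1sq] at most 4 eta. *)
Lemma integral_pow4_le_H1sq F DF eta : H1_0 F DF -> sqH1 F DF < eta ->
  (\int[leb]_(x in Omega) ((mxdot (F x) (F x)) ^+ 2)%:E <=
    (512 * d%:R ^+ 2 * eta ^+ 2)%:E)%E.
Proof.
move=> [LF LDF apx] Feta; have [mF iF] := LF.
have eta0 : 0 < eta by apply: le_lt_trans Feta; exact: H1sq_ge0.
pose a x := mxdot (F x) (F x).
have a0 x : 0 <= a x by exact: mxdot_ge0.
have ma : measurable_fun Omega a by exact: measurable_fun_mxdot.
pose g (m : nat) x := (Num.min (a x) m%:R * a x)%:E.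
have g0 m x : (0 <= g m x)%E by rewrite lee_fin mulr_ge0// le_min a0/=.
have mg m : measurable_fun Omega (g m).
  by apply/measurable_EFinP; apply: measurable_funM => //; exact: measurable_minr.
have key m : (\int[leb]_(x in Omega) g m x <= (512 * d%:R ^+ 2 * eta ^+ 2)%:E)%E.
  apply/lee_addgt0Pr => e e0.
  (* eta keeps the approximating field bounded in H^1, and the other bound makes
     4 m c integrate to at most e *)
  pose del := Num.min eta (e / (4 * m%:R + 1)).
  have del0 : 0 < del.
    by rewrite lt_min eta0 divr_gt0// ltr_wpDl// mulr_ge0.
  have [phi tphi phid] := apx _ del0.
  have Lp := test_field_L2 oO tphi; have [mp ip] := Lp.
  have [mFp iFp] := L2_sub mO LF Lp.
  have [phi1 phi2] : sqH1 (fun x => F x - phi x) (fun x => DF x - gradient phi x) < eta /\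
      sqH1 (fun x => F x - phi x) (fun x => DF x - gradient phi x) < e / (4 * m%:R + 1).
    by move: phid; rewrite /del lt_min => /andP[].
  pose b x := mxdot (phi x) (phi x).
  pose c x := mxdot (F x - phi x) (F x - phi x).
  have mb : measurable_fun Omega b by exact: measurable_fun_mxdot.
  have mc : measurable_fun Omega c by exact: measurable_fun_mxdot.
  have b0 x : 0 <= b x by exact: mxdot_ge0.
  have c0 x : 0 <= c x by exact: mxdot_ge0.
  have m4 : (0 : R) <= 4 * m%:R by rewrite mulr_ge0.
  have mb2 : measurable_fun Omega (fun x => (b x ^+ 2)%:E).
    by apply/measurable_EFinP; exact: measurable_funX.
  have mcE : measurable_fun Omega (fun x => (c x)%:E) by exact/measurable_EFinP.
  apply: (@le_trans _ _ (\int[leb]_(x in Omega)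
      (16%:E * (b x ^+ 2)%:E + (4 * m%:R)%:E * (c x)%:E))%E).
    apply: ge0_le_integral => //.
      by apply: emeasurable_funD; exact: measurable_funeM.
    move=> x _; rewrite -!EFinM -EFinD lee_fin.
    apply: truncated_sqr_le => //.
    have := mxdot_add_le (phi x) (F x - phi x).
    by rewrite addrC subrK.
  rewrite ge0_integralD//; last 4 first.
  - by move=> x _; rewrite -EFinM lee_fin mulr_ge0// sqr_ge0.
  - exact: measurable_funeM.
  - by move=> x _; rewrite -EFinM lee_fin mulr_ge0.
  - exact: measurable_funeM.
  rewrite ge0_integralZl//; last by move=> x _; rewrite lee_fin sqr_ge0.
  rewrite ge0_integralZl//; last by move=> x _; rewrite lee_fin.
  apply: leeD.
    apply: (@le_trans _ _ (16%:E * (2 * d%:R ^+ 2 * sqH1 phi (gradient phi) ^+ 2)%:E)%E).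
      by apply: lee_wpmul2l => //; exact: test_field_L4.
    rewrite -EFinM lee_fin.
    have h4 : sqH1 phi (gradient phi) <= 4 * eta.
      by have := H1sq_triangle LF LDF tphi; move: Feta phi1; lra.
    have h5 : sqH1 phi (gradient phi) ^+ 2 <= (4 * eta) ^+ 2.
      by rewrite ler_sqr ?nnegrE ?H1sq_ge0// mulr_ge0// ltW.
    have h6 := ler_wpM2l (sqr_ge0 (d%:R : R)) h5.
    by move: h6; lra.
  have -> : (\int[leb]_(x in Omega) (c x)%:E)%E = (\int[leb]_(x in Omega) c x)%:E.
    by rewrite fineK//; exact: integrable_fin_num.
  rewrite -EFinM lee_fin.
  apply: (@le_trans _ _ (4 * m%:R * (e / (4 * m%:R + 1)))).
    apply: ler_wpM2l => //; apply: le_trans (ltW phi2).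
    by rewrite /H1sq /L2ip lerDl; exact: (L2ip_ge0 (Omega := Omega)).
  rewrite mulrA ler_pdivrMr; last by rewrite ltr_wpDl.
  by rewrite mulrC ler_pM2l// lerDl.
have nd x : nondecreasing_seq (g ^~ x).
  move=> m n mn; rewrite lee_fin ler_wpM2r// le_min ge_min lexx/=.
  by rewrite ge_min ler_nat mn orbT.
have lim x : limn (g ^~ x) = (a x ^+ 2)%:E.
  apply/cvg_lim => //; apply: cvg_near_cst.
  near=> m; rewrite /g; have am : a x <= m%:R by near: m; exact: nbhs_infty_ger.
  by rewrite min_l// expr2.
rewrite (_ : (\int[_]_(x in _) _)%E = (\int[leb]_(x in Omega) limn (g ^~ x))%E); last first.
  by apply: eq_integral => x _; rewrite lim.
rewrite monotone_convergence//.
apply: lime_le.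
  apply: ereal_nondecreasing_is_cvgn => m n mn; apply: ge0_le_integral => //.
  by move=> x _; exact: nd.
by apply: nearW.
Unshelve. all: by end_near. Qed.

End H1_0_theory.

(** * Outer products and scalar square-integrable functions *)

Section outer_products.
Context {R : realType} {d : nat} {Omega : set 'rV[R]_d}.
Hypothesis mO : measurable Omega.
Local Notation E := 'rV[R]_d.
Local Notation leb := (@lebesgue_rV R d).
Implicit Types F G : E -> 'rV[R]_d.

(** This identity makes the convective form an L^2 inner product of a gradient and an
outer product. *)
Lemma mxdot_mulmx (u v : 'rV[R]_d) (A : 'M[R]_d) :
  mxdot (u *m A) v = mxdot A (u^T *m v).
Proof.
rewrite /mxdot big_ord1; under eq_bigr do rewrite mxE mulr_suml.
rewrite exchange_big; apply: eq_bigr => i _; apply: eq_bigr => j _.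
by rewrite mxE big_ord1 !mxE; ring.
Qed.

Lemma mxdot_outer (u v : 'rV[R]_d) :
  mxdot (u^T *m v) (u^T *m v) = mxdot u u * mxdot v v.
Proof.
rewrite /mxdot !big_ord1 mulr_suml; apply: eq_bigr => i _.
by rewrite mulr_sumr; apply: eq_bigr => j _; rewrite mxE big_ord1 !mxE; ring.
Qed.

Definition L4 F := measurable_fun Omega F /\
  leb.-integrable Omega (EFin \o (fun x => mxdot (F x) (F x) ^+ 2)).

Lemma measurable_outer F G : measurable_fun Omega F -> measurable_fun Omega G ->
  measurable_fun Omega (fun x => (F x)^T *m G x).
Proof.
move=> mF mG; apply: measurable_fun_mx_on => // i j.
rewrite (_ : (fun x => _) = (fun x => F x ord0 i * G x ord0 j)); last first.
  by apply/funext => x; rewrite mxE big_ord1 mxE.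
by apply: measurable_funM; exact: measurable_fun_entry.
Qed.

Lemma L2_outer F G : L4 F -> L4 G -> L2 Omega (fun x => (F x)^T *m G x).
Proof.
move=> [mF iF] [mG iG]; have mFG := measurable_outer mF mG.
split=> //.
apply: (le_integrable mO _ _ (integrableD mO iF iG)).
  by apply/measurable_EFinP; exact: measurable_fun_mxdot.
move=> x _; rewrite /= lee_fin mxdot_outer.
have a0 := mxdot_ge0 (F x); have b0 := mxdot_ge0 (G x).
rewrite !ger0_norm ?addr_ge0 ?sqr_ge0 ?mulr_ge0//.
by have := sqr_ge0 (mxdot (F x) (F x) - mxdot (G x) (G x)); have := mulr_ge0 a0 b0; lra.
Qed.

(** With the free parameter s, the right-hand side is small when the fourth powers
of G are of order s^2. *)
Lemma L2ip_outer_le s F G : 0 < s -> L4 F -> L4 G ->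
  L2ip Omega (fun x => (F x)^T *m G x) (fun x => (F x)^T *m G x) <=
  s * (\int[leb]_(x in Omega) mxdot (F x) (F x) ^+ 2) +
  s^-1 * (\int[leb]_(x in Omega) mxdot (G x) (G x) ^+ 2).
Proof.
move=> s0 LF LG; have [mF iF] := LF; have [mG iG] := LG.
have iF' := integrableZl mO s iF; have iG' := integrableZl mO s^-1 iG.
rewrite -(RintegralZl _ mO iF) -(RintegralZl _ mO iG) -RintegralD//.
have LO := L2_outer LF LG.
apply: le_Rintegral => //; first exact: L2_integrable.
  exact: (integrableD mO iF' iG').
move=> x _; rewrite mxdot_outer.
set a := mxdot _ _; set b := mxdot _ _.
have -> : s * a ^+ 2 + s^-1 * b ^+ 2 = s^-1 * (s * a - b) ^+ 2 + 2 * (a * b).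
  by field; rewrite gt_eqF.
have ab : 0 <= a * b by rewrite mulr_ge0// mxdot_ge0.
have : 0 <= s^-1 * (s * a - b) ^+ 2 by rewrite mulr_ge0 ?sqr_ge0// invr_ge0 ltW.
by lra.
Qed.

End outer_products.

Section scalar_L2.
Context {R : realType} {d : nat} {Omega : set 'rV[R]_d}.
Hypothesis mO : measurable Omega.
Local Notation E := 'rV[R]_d.
Local Notation leb := (@lebesgue_rV R d).
Implicit Types f g : E -> R.

(** The predicate [L2] concerns matrix fields; this is its counterpart for real-valued
functions, with the results carried over from 1 x 1 matrices. *)
Definition sL2 f := measurable_fun Omega f /\
  leb.-integrable Omega (EFin \o (fun x => f x ^+ 2)).

Let w f x : 'M[R]_1 := const_mx (f x).

Let wE f g x : mxdot (w f x) (w g x) = f x * g x.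
Proof. by rewrite /mxdot !big_ord1 !mxE. Qed.

Let wL f : sL2 f -> L2 Omega (w f).
Proof.
move=> [mf i_f]; split.
  apply: measurable_fun_mx_on => // i j.
  by rewrite (_ : (fun x => _) = f)//; apply/funext => x; rewrite mxE.
by apply: eq_integrable i_f => // x _; rewrite /= wE expr2.
Qed.

Lemma sL2_integrable f g : sL2 f -> sL2 g ->
  leb.-integrable Omega (EFin \o (fun x => f x * g x)).
Proof.
move=> Lf Lg; apply: eq_integrable (L2_integrable mO (wL Lf) (wL Lg)) => // x _.
by rewrite /= wE.
Qed.

Lemma sL2_CS f g : sL2 f -> sL2 g ->
  (\int[leb]_(x in Omega) (f x * g x)) ^+ 2 <=
  (\int[leb]_(x in Omega) f x ^+ 2) * (\int[leb]_(x in Omega) g x ^+ 2).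
Proof.
move=> Lf Lg; have := L2ip_CS mO (wL Lf) (wL Lg); rewrite /L2ip.
under eq_Rintegral do rewrite wE.
under [X in _ <= X * _]eq_Rintegral do rewrite wE -expr2.
by under [X in _ <= _ * X]eq_Rintegral do rewrite wE -expr2.
Qed.

Lemma sL2_entry m n (F : E -> 'M[R]_(m, n)) i j :
  L2 Omega F -> sL2 (fun x => F x i j).
Proof.
move=> [mF iF]; have mFij := measurable_fun_entry i j mF.
split=> //; apply: (le_integrable mO _ _ iF).
  by apply/measurable_EFinP; exact: measurable_funX.
move=> x _; rewrite /= lee_fin !ger0_norm ?sqr_ge0 ?mxdot_ge0//.
rewrite /mxdot (bigD1 i)//= (bigD1 j)//= expr2 -addrA lerDl addr_ge0//.
  by apply: sumr_ge0 => k _; rewrite -expr2 sqr_ge0.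
by apply: sumr_ge0 => k _; apply: sumr_ge0 => l _; rewrite -expr2 sqr_ge0.
Qed.

Lemma sL2_add f g : sL2 f -> sL2 g -> sL2 (fun x => f x + g x).
Proof.
move=> Lf Lg; have [mf i_f] := Lf; have [mg i_g] := Lg.
split; first exact: measurable_funD.
have i2 := integrableD mO (integrableD mO i_f i_g)
  (integrableZl mO 2 (sL2_integrable Lf Lg)).
by apply: eq_integrable i2 => // x _; rewrite /= -EFinM -!EFinD; congr EFin; ring.
Qed.

Lemma sL2_scale a f : sL2 f -> sL2 (fun x => a * f x).
Proof.
move=> [mf i_f]; split; first exact: measurable_funM.
have i2 := integrableZl mO (a ^+ 2) i_f.
by apply: eq_integrable i2 => // x _; rewrite /= -EFinM exprMn.
Qed.

Lemma Rintegral_sum n (h : 'I_n -> E -> R) :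
  (forall i, leb.-integrable Omega (EFin \o h i)) ->
  \int[leb]_(x in Omega) (\sum_i h i x) = \sum_i \int[leb]_(x in Omega) h i x.
Proof.
move=> ih; rewrite /Rintegral.
under eq_integral do rewrite -sumEFin.
rewrite (integral_sum mO (f := fun i x => (h i x)%:E))//.
rewrite (eq_bigr (fun i => (\int[leb]_(x in Omega) h i x)%:E)) ?sumEFin//.
by move=> i _; rewrite fineK//; apply: integrable_fin_num => //; exact: ih.
Qed.

End scalar_L2.

(** * Divergence-free fields *)

Section divergence_free.
Context {R : realType} {d : nat} {Omega : set 'rV[R]_d}.
Hypothesis oO : open Omega.
Local Notation E := 'rV[R]_d.
Local Notation leb := (@lebesgue_rV R d).

Let mO : measurable Omega := open_measurable_mx oO.

Lemma integrable_indic_sub (A : set E) : measurable A -> A `<=` Omega ->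
  (leb A < +oo)%E -> leb.-integrable Omega (EFin \o (\1_A : E -> R)).
Proof.
move=> mA AO fA; apply/integrableP; split.
  by apply/measurable_EFinP; exact: measurable_indic.
rewrite (_ : (\int[_]_(x in _) _)%E = (\int[leb]_(x in Omega) (\1_A x : R)%:E)%E).
  by rewrite integral_indic// setIidl.
by apply: eq_integral => x _; rewrite /= ger0_norm.
Qed.

Lemma sL2_indic (A : set E) : measurable A -> A `<=` Omega -> (leb A < +oo)%E ->
  sL2 (Omega := Omega) \1_A.
Proof.
move=> mA AO fA; split; first exact: measurable_indic.
have i1 : leb.-integrable Omega (EFin \o \1_A).
  by apply: integrable_indic_sub.
apply: eq_integrable i1 => // x _ /=; rewrite indicE.
by case: (x \in A); rewrite ?expr1n ?expr0n.
Qed.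

Lemma Rintegral_indic (A : set E) : measurable A -> A `<=` Omega ->
  \int[leb]_(x in Omega) (\1_A x : R) = fine (leb A).
Proof. by move=> mA AO; rewrite /Rintegral integral_indic// setIidl. Qed.

(** Any g in L^1 and L^2 becomes a function of mean zero after subtracting a
multiple of the indicator function of a set of finite positive measure. *)
Lemma spaceQ_sub_mean (A : set E) (g : E -> R) : measurable A -> A `<=` Omega ->
  (leb A < +oo)%E -> (0 < leb A)%E -> sL2 (Omega := Omega) g ->
  leb.-integrable Omega (EFin \o g) ->
  spaceQ Omega (fun x => g x + - ((\int[leb]_(x in Omega) g x) / fine (leb A)) * \1_A x).
Proof.
move=> mA AO fA A0 Lg ig; set c := - _.
have LI := sL2_indic mA AO fA.
have [mq iq] := sL2_add mO Lg (sL2_scale mO c LI).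
have i1 : leb.-integrable Omega (EFin \o \1_A).
  by apply: integrable_indic_sub.
have ic : leb.-integrable Omega (EFin \o (fun x => c * \1_A x)).
  exact: (integrableZl mO c i1).
split=> //.
have iq1 : leb.-integrable Omega (EFin \o (fun x => g x + c * \1_A x)).
  exact: (integrableD mO ig ic).
rewrite -[LHS]fineK; last exact: integrable_fin_num.
rewrite -/(Rintegral _ _ _) RintegralD// RintegralZl// Rintegral_indic//.
have fA0 : fine (leb A) != 0 by rewrite gt_eqF// fine_gt0// A0.
by rewrite /c mulNr divfK// subrr.
Qed.

Lemma sL2_divergence (v : H1 Omega) : sL2 (Omega := Omega) (divergence v).
Proof.
have [mv iv] := h1_gradL2 v.
have mD : measurable_fun Omega (divergence v).
  by apply: measurable_sum => i; exact: measurable_fun_entry.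
split=> //.
apply: (le_integrable mO _ _ (integrableZl mO d%:R iv)).
  by apply/measurable_EFinP; exact: measurable_funX.
move=> x _; rewrite /= lee_fin !ger0_norm ?sqr_ge0 ?mulr_ge0 ?mxdot_ge0//.
apply: le_trans (sqr_sum_le _) _; rewrite ler_wpM2l// ler_sum// => i _.
by rewrite (bigD1 i)//= -expr2 lerDl sumr_ge0// => j _; rewrite -expr2 sqr_ge0.
Qed.

(** The divergence is orthogonal to functions of mean zero, so that its
pairing with g depends on the integral of g only. *)
Lemma integral_divergenceM_mean (v : H1 Omega) (A : set E) (g : E -> R) :
  spaceV v -> measurable A -> A `<=` Omega ->
  (leb A < +oo)%E -> (0 < leb A)%E -> sL2 (Omega := Omega) g ->
  leb.-integrable Omega (EFin \o g) ->
  \int[leb]_(x in Omega) (divergence v x * g x) =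
  (\int[leb]_(x in Omega) g x) / fine (leb A) *
  \int[leb]_(x in Omega) (divergence v x * \1_A x).
Proof.
move=> [_ vV] mA AO fA A0 Lg ig.
have := vV _ (spaceQ_sub_mean mA AO fA A0 Lg ig); set c := _ / _.
have LD := sL2_divergence v; have LI := sL2_indic mA AO fA.
have i1 := sL2_integrable mO LD Lg.
have i2 := sL2_integrable mO LD LI.
rewrite (_ : \int[leb]_(x in Omega) _ = \int[leb]_(x in Omega)
  (divergence v x * g x - c * (divergence v x * \1_A x))); last first.
  by apply: eq_Rintegral => x _; ring.
rewrite RintegralB//; last exact: (integrableZl mO c i2).
by rewrite RintegralZl// => /eqP; rewrite subr_eq0 => /eqP.
Qed.

Lemma spaceX_H1_0 (v : H1 Omega) : spaceX v -> H1_0 (Omega := Omega) v (h1_grad v).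
Proof.
move=> vX; split; [exact: h1_funL2|exact: h1_gradL2|move=> eta eta0].
have se : 0 < Num.sqrt eta by rewrite sqrtr_gt0.
have [phi [tphi h]] := vX _ se; exists phi => //.
move: h; rewrite /H1norm !L2normE => h.
by rewrite -(ltr_sqrt _ eta0).
Qed.

(** For a test field the integral of the divergence is zero, and when Omega
has finite measure the integral is the L^2 inner product of the gradient with the identity matrix,
hence continuous in H^1. *)
Lemma integral_divergence_eq0 (v : H1 Omega) : spaceX v -> (leb Omega < +oo)%E ->
  \int[leb]_(x in Omega) divergence v x = 0.
Proof.
move=> vX fO; have [_ LDv apx] := spaceX_H1_0 vX.
have trE (A : 'M[R]_d) : mxdot A 1%:M = \tr A.
  apply: eq_bigr => i _; rewrite (bigD1 i)//= mxE eqxx mulr1 big1 ?addr0// => j ji.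
  by rewrite mxE eq_sym (negbTE ji) mulr0.
have L1 : L2 Omega (cst 1%:M : E -> 'M[R]_d).
  split; first exact: measurable_cst.
  have i1 := integrableZl mO (mxdot (1%:M : 'M[R]_d) 1%:M)
    (integrable_indic_sub mO (@subset_refl _ Omega) fO).
  by apply: eq_integrable i1 => // x xO; rewrite /= indicE xO -EFinM mulr1.
have -> : \int[leb]_(x in Omega) divergence v x = L2ip Omega (h1_grad v) (cst 1%:M).
  by apply: eq_Rintegral => x _; rewrite trE.
have phi0 phi : test_field (Omega := Omega) phi ->
    L2ip Omega (gradient phi) (cst 1%:M) = 0.
  move=> tphi.
  have ip i : leb.-integrable Omega (EFin \o (partial i (fun y => phi y ord0 i))).
    have [M fM] := test_fun_C1c (tphi i).
    apply: (@integrableS _ _ _ _ setT) => //; apply: box_supp_integrable.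
      exact: C1c_cont_partial fM.
    exact: C1c_supp_partial fM i.
  rewrite (_ : L2ip _ _ _ = \int[leb]_(x in Omega)
      (\sum_i partial i (fun y => phi y ord0 i) x)); last first.
    by apply: eq_Rintegral => x _; rewrite trE; apply: eq_bigr => i _; rewrite mxE.
  rewrite Rintegral_sum// big1// => i _.
  have [M fM] := test_fun_C1c (tphi i).
  rewrite Rintegral_mkcond (_ : _ \_ _ = partial i (fun y => phi y ord0 i)).
    by rewrite /Rintegral (integral_partial _ fM).
  apply/funext => x; rewrite patchE; case: ifPn => // /negP; rewrite inE.
  by move=> /(test_fun_off (tphi i))[_ ->].
apply/eqP; rewrite -sqrf_eq0 eq_le sqr_ge0 andbT.
pose K := L2ip Omega (cst 1%:M : E -> 'M[R]_d) (cst 1%:M).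
have K0 : 0 <= K by exact: L2ip_ge0.
apply: (le_of_le_addM K0) => e e0 _; rewrite add0r.
have [phi tphi phie] := apx _ e0.
have Lg := test_field_gradient_L2 oO tphi.
have := L2ip_CS mO (L2_sub mO LDv Lg) L1; rewrite L2ip_subl// phi0// subr0 => h.
apply: le_trans h _; rewrite mulrC ler_wpM2l//.
by apply: le_trans (ltW phie); rewrite /H1sq lerDr; exact: L2ip_ge0.
Qed.

(** In the formula of [integral_divergenceM_mean], take A = Omega if its
measure is finite. Otherwise let A grow: by Cauchy-Schwarz the integral of the divergence over
A is at most a constant times the square root of the measure of A, which is divided by the
measure of A. *)
Lemma integral_divergenceM_eq0 (v : H1 Omega) (g : E -> R) : spaceV v ->
  sL2 (Omega := Omega) g -> leb.-integrable Omega (EFin \o g) ->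
  \int[leb]_(x in Omega) (divergence v x * g x) = 0.
Proof.
move=> vV Lg ig; have LD := sL2_divergence v.
have [zO|zO] := eqVneq (leb Omega) 0%E.
  rewrite /Rintegral null_set_integral//.
  exact: measurable_int (sL2_integrable mO LD Lg).
have O0' : (0 < leb Omega)%E by rewrite lt0e zO measure_ge0.
have [fO|OI'] := boolP (leb Omega < +oo)%E.
  rewrite (integral_divergenceM_mean vV mO (@subset_refl _ Omega) fO O0' Lg ig).
  rewrite (_ : \int[leb]_(x in Omega) (_ * _) = \int[leb]_(x in Omega) divergence v x).
    by rewrite integral_divergence_eq0 ?mulr0//; case: vV.
  by apply: eq_Rintegral => x xO; rewrite indicE xO mulr1.
have OI : leb Omega = +oo%E by apply/eqP; rewrite -leye_eq leNgt.
have /sigma_finiteP[F [TF ndF Foo]] := sigma_finiteT leb.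
pose A n := Omega `&` F n.
have mA n : measurable (A n) by apply: measurableI => //; case: (Foo n).
have AO n : A n `<=` Omega by exact: subIsetl.
have fA n : (leb (A n) < +oo)%E.
  have [mF Fn] := Foo n; apply: le_lt_trans Fn.
  by apply: le_measure; rewrite ?inE//; exact: subIsetr.
have UA : \bigcup_n A n = Omega by rewrite -setI_bigcupr -TF setIT.
have cA : leb (A n) @[n --> \oo] --> +oo%E.
  rewrite -OI -[in X in _ --> X]UA; apply: nondecreasing_cvg_mu => //.
    by rewrite UA.
  by move=> m n mn; apply/subsetPset; apply: setIS; apply/subsetPset; exact: ndF.
pose s := \int[leb]_(x in Omega) g x.
pose D2 := \int[leb]_(x in Omega) divergence v x ^+ 2.
pose K := s ^+ 2 * D2.
have K0 : 0 <= K by rewrite mulr_ge0 ?sqr_ge0//; apply: Rintegral_ge0 => x _; exact: sqr_ge0.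
apply/eqP; rewrite -sqrf_eq0 eq_le sqr_ge0 andbT.
apply: (le_of_le_addM K0) => e e0 _; rewrite add0r.
have [n An] : exists n, (e^-1%:E < leb (A n))%E.
  have /cvgeyPgt/(_ e^-1)[N _ h] := cA; exists N; exact: (h N (leqnn N)).
have e'0 : 0 < e^-1 by rewrite invr_gt0.
have An0 : (0 < leb (A n))%E by apply: lt_trans An; rewrite lte_fin.
rewrite (integral_divergenceM_mean vV (mA n) (AO n) (fA n) An0 Lg ig).
have LI := sL2_indic (mA n) (AO n) (fA n).
have := sL2_CS mO LD LI; rewrite [X in _ <= _ * X](_ : _ = fine (leb (A n))); last first.
  rewrite -Rintegral_indic//; apply: eq_Rintegral => x _; rewrite indicE.
  by case: (x \in _); rewrite ?expr1n ?expr0n.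
have : e^-1 < fine (leb (A n)) by rewrite -lte_fin fineK// ge0_fin_numE.
rewrite /K -/s -/D2; set a := fine _; set t := Rintegral _ _ _ => ea h.
have a0 : 0 < a by exact: lt_trans ea.
rewrite exprMn expr_div_n.
apply: (@le_trans _ _ (s ^+ 2 / a ^+ 2 * (D2 * a))).
  by rewrite ler_wpM2l// divr_ge0 ?sqr_ge0.
have -> : s ^+ 2 / a ^+ 2 * (D2 * a) = s ^+ 2 * D2 * a^-1 by field; rewrite gt_eqF.
apply: ler_wpM2l => //.
by rewrite -[e]invrK lef_pV2 ?posrE// ltW.
Qed.

End divergence_free.

(** * The convective term *)

Section convection.
Context {R : realType} {d : nat} {Omega : set 'rV[R]_d}.
Hypothesis oO : open Omega.
Hypothesis d23 : d = 2%N \/ d = 3%N.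
Local Notation E := 'rV[R]_d.
Local Notation leb := (@lebesgue_rV R d).
Local Notation H1_0 := (@H1_0 R d Omega).
Local Notation test_field := (@test_field R d Omega).

Let mO : measurable Omega := open_measurable_mx oO.

Lemma sL2_test f : test_fun Omega f -> sL2 (Omega := Omega) f.
Proof.
move=> tf; split; last exact: test_fun_integrable_sqr.
have [M fM] := test_fun_C1c tf; apply: measurable_funTS.
by apply: continuous_measurable_mx; exact: C1c_cont fM.
Qed.

Lemma test_fun_integrable f : test_fun Omega f -> leb.-integrable Omega (EFin \o f).
Proof.
move=> tf; have [M fM] := test_fun_C1c tf; apply: (@integrableS _ _ _ _ setT) => //.
by apply: box_supp_integrable; [exact: C1c_cont fM|exact: C1c_supp fM].
Qed.

(** Here phi_j d_i phi_j = d_i (phi_j^2) / 2, and phi_j^2 is a test function: the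
weak gradient of u moves the derivative to u, where the divergence appears. *)
Lemma convection_test_eq0 (u : H1 Omega) phi : spaceV u -> test_field phi ->
  L2ip Omega (gradient phi) (fun x => (u x)^T *m phi x) = 0.
Proof.
move=> uV tphi.
pose psi j x := phi x ord0 j * phi x ord0 j.
have tpsi j : test_fun Omega (psi j) by apply: test_funMl => //; case: (tphi j).
have Lu i : sL2 (Omega := Omega) (fun x => u x ord0 i) by apply: sL2_entry => //; exact: h1_funL2.
have LDu i : sL2 (Omega := Omega) (fun x => h1_grad u x i i).
  by apply: sL2_entry => //; exact: h1_gradL2.
have Lpsi j : sL2 (Omega := Omega) (psi j) by exact: sL2_test.
have Ldpsi i j : sL2 (Omega := Omega) (partial i (psi j)).
  by apply: sL2_test; exact: test_fun_partial.
have i1 i j := sL2_integrable mO (Lu i) (Ldpsi i j).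
have i2 i j := sL2_integrable mO (LDu i) (Lpsi j).
(* half of the sum of the h j is the integrand *)
pose h j x := \sum_i (u x ord0 i * partial i (psi j) x).
have ih j : leb.-integrable Omega (EFin \o h j).
  have := @integrable_sum _ _ _ leb Omega mO _ (index_enum 'I_d) xpredT
    (fun i x => (u x ord0 i * partial i (psi j) x)%:E) (fun i _ => i1 i j).
  by apply: eq_integrable => // x _; rewrite /= sumEFin.
have h0 j : \int[leb]_(x in Omega) h j x = 0.
  rewrite Rintegral_sum//.
  transitivity (- \sum_i \int[leb]_(x in Omega) (h1_grad u x i i * psi j x)).
    by rewrite -sumrN; apply: eq_bigr => i _; exact: h1_weak_grad.
  rewrite -Rintegral_sum// -[RHS]oppr0; congr (- _).
  rewrite -[RHS](integral_divergenceM_eq0 oO uV (Lpsi j) (test_fun_integrable (tpsi j))).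
  by apply: eq_Rintegral => x _; rewrite /divergence /mxtrace mulr_suml.
have ihsum : leb.-integrable Omega (EFin \o (fun x => \sum_j h j x)).
  have := @integrable_sum _ _ _ leb Omega mO _ (index_enum 'I_d) xpredT
    (fun j x => (h j x)%:E) (fun j _ => ih j).
  by apply: eq_integrable => // x _; rewrite /= sumEFin.
transitivity (\int[leb]_(x in Omega) (2^-1 * \sum_j h j x)); last first.
  by rewrite RintegralZl// Rintegral_sum// big1 ?mulr0// => j _; exact: h0.
apply: eq_Rintegral => x _; rewrite /mxdot exchange_big mulr_sumr.
apply: eq_bigr => j _; rewrite mulr_sumr; apply: eq_bigr => i _.
rewrite !mxE big_ord1 !mxE.
have dphi y : derivable (fun x => phi x ord0 j) y (delta_mx ord0 i).
  by apply: smooth_derivable; case: (tphi j).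
by rewrite /psi (partialM dphi dphi) /=; field.
Qed.

Lemma H1sq_lin_le a F DF G DG : L2 Omega F -> L2 Omega DF ->
  L2 Omega G -> L2 Omega DG ->
  H1sq (Omega := Omega) (fun x => a *: F x + G x) (fun x => a *: DF x + DG x) <=
  2 * a ^+ 2 * H1sq (Omega := Omega) F DF + 2 * H1sq (Omega := Omega) G DG.
Proof.
have one m n (A B : E -> 'M[R]_(m, n)) : L2 Omega A -> L2 Omega B ->
    L2ip Omega (fun x => a *: A x + B x) (fun x => a *: A x + B x) <=
    2 * a ^+ 2 * L2ip Omega A A + 2 * L2ip Omega B B.
  move=> LA LB; have LC := L2_lin mO a LA LB.
  have iA := L2_integrable mO LA LA; have iB := L2_integrable mO LB LB.
  have iA2 := integrableZl mO (2 * a ^+ 2) iA; have iB2 := integrableZl mO 2 iB.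
  rewrite /L2ip -(RintegralZl _ mO iA) -(RintegralZl _ mO iB) -RintegralD//.
  apply: le_Rintegral => //; first exact: L2_integrable.
    exact: (integrableD mO iA2 iB2).
  move=> x _; apply: le_trans (mxdot_add_le _ _) _.
  by rewrite mxdotZl mxdotZr !mulrA -[2 * a * a]mulrA -expr2.
move=> LF LDF LG LDG; apply: le_trans (lerD (one _ _ _ _ LF LG) (one _ _ _ _ LDF LDG)) _.
by rewrite /H1sq !mulrDr addrACA.
Qed.

Lemma H1_0_lin a F DF G DG : H1_0 F DF -> H1_0 G DG ->
  H1_0 (fun x => a *: F x + G x) (fun x => a *: DF x + DG x).
Proof.
move=> [LF LDF aF] [LG LDG aG]; split; [exact: L2_lin|exact: L2_lin|move=> eta eta0].
(* the constant by which [H1sq_lin_le] amplifies the approximation errors *)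
pose K := 2 * a ^+ 2 + 2.
have K0 : 0 < K by rewrite ltr_wpDl// mulr_ge0// sqr_ge0.
have eK : 0 < eta / K by rewrite divr_gt0.
have [phi tphi h1] := aF _ eK; have [psi tpsi h2] := aG _ eK.
exists (fun x => a *: phi x + psi x); first exact: test_field_lin.
have Lphi := test_field_L2 oO tphi; have LDphi := test_field_gradient_L2 oO tphi.
have Lpsi := test_field_L2 oO tpsi; have LDpsi := test_field_gradient_L2 oO tpsi.
have := H1sq_lin_le a (L2_sub mO LF Lphi) (L2_sub mO LDF LDphi)
  (L2_sub mO LG Lpsi) (L2_sub mO LDG LDpsi).
set X := H1sq _ _ in h1; set Y := H1sq _ _ in h2 * => h.
rewrite (_ : H1sq _ _ = H1sq (Omega := Omega)
   (fun x => a *: (F x - phi x) + (G x - psi x))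
   (fun x => a *: (DF x - gradient phi x) + (DG x - gradient psi x))).
  apply: le_lt_trans h _.
  apply: (@lt_le_trans _ _ (K * (eta / K))); last by rewrite mulrCA divff ?mulr1// gt_eqF.
  rewrite [ltRHS]mulrDl; apply: ler_ltD; last by rewrite ltr_pM2l.
  by apply: ler_wpM2l (ltW h1); rewrite mulr_ge0// sqr_ge0.
congr H1sq; apply/funext => x.
  by rewrite scalerBr opprD addrACA.
by rewrite (gradient_lin a tphi tpsi) scalerBr opprD addrACA.
Qed.

Lemma H1_0_test phi : test_field phi -> H1_0 phi (gradient phi).
Proof.
move=> tphi; split; [exact: test_field_L2|exact: test_field_gradient_L2|].
move=> eta eta0; exists phi => //; rewrite (_ : H1sq _ _ = 0)//.
have mxdot0 m n (A : 'M[R]_(m, n)) : mxdot (A - A) (A - A) = 0.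
  by rewrite subrr -[X in mxdot X _](scale0r A) mxdotZl mul0r.
rewrite /H1sq /L2ip; under eq_Rintegral do rewrite mxdot0.
under [X in _ + X]eq_Rintegral do rewrite mxdot0.
by rewrite Rintegral_cst// mul0r addr0.
Qed.

Lemma H1_0_sub_test F DF phi : H1_0 F DF -> test_field phi ->
  H1_0 (fun x => F x - phi x) (fun x => DF x - gradient phi x).
Proof.
move=> HF /H1_0_test Hphi; have := H1_0_lin (-1) Hphi HF.
by rewrite (_ : (fun x => _ + F x) = (fun x => F x - phi x))
     1?(_ : (fun x => _ + DF x) = (fun x => DF x - gradient phi x))//;
   apply/funext => x; rewrite scaleN1r addrC.
Qed.

Lemma H1_0_L4 F DF : H1_0 F DF -> L4 (Omega := Omega) F.
Proof.
move=> HF; have [[mF iF] _ _] := HF; split=> //.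
have FF : H1sq (Omega := Omega) F DF < H1sq (Omega := Omega) F DF + 1 by rewrite ltrDl.
apply/integrableP; split.
  by apply/measurable_EFinP; apply: measurable_funX; exact: measurable_fun_mxdot.
rewrite (_ : (\int[_]_(x in _) _)%E =
  (\int[leb]_(x in Omega) (mxdot (F x) (F x) ^+ 2)%:E)%E); last first.
  by apply: eq_integral => x _; rewrite /= ger0_norm// sqr_ge0.
by apply: le_lt_trans (integral_pow4_le_H1sq oO d23 HF FF) _; rewrite ltry.
Qed.

(** For r = F - phi with phi a test field close to F, bilinearity and
[convection_test_eq0] give b(u, F, F) = b(u, r, F) + b(u, F, r) - b(u, r, r), and each term
is small by Cauchy-Schwarz and the L^4 bound of r. *)
Lemma convection_eq0 (u : H1 Omega) F DF : spaceV u -> H1_0 F DF ->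
  L2ip Omega DF (fun x => (u x)^T *m F x) = 0.
Proof.
move=> uV HF; have [LF LDF apx] := HF.
have Hu : H1_0 u (h1_grad u) by apply: spaceX_H1_0; case: uV.
have u4 := H1_0_L4 Hu; have F4 := H1_0_L4 HF.
pose W (v : E -> 'rV[R]_d) x := (u x)^T *m v x.
pose U := \int[leb]_(x in Omega) mxdot (u x) (u x) ^+ 2.
pose C : R := 512 * d%:R ^+ 2.
have U0 : 0 <= U by apply: Rintegral_ge0 => x _; exact: sqr_ge0.
have C0 : 0 <= C by apply: mulr_ge0; [exact: ler0n|exact: sqr_ge0].
have LWF : L2 Omega (W F) by exact: L2_outer.
pose X := L2ip Omega (W F) (W F); pose Y := L2ip Omega DF DF.
have X0 : 0 <= X by exact: L2ip_ge0.
have Y0 : 0 <= Y by exact: L2ip_ge0.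
(* the square of a sum of three terms, with squares at most e X, e Y (U + C)
   and e (U + C) *)
pose K := 3 * (X + (Y + 1) * (U + C)).
have K0 : 0 <= K by rewrite mulr_ge0// addr_ge0// mulr_ge0// addr_ge0.
apply/eqP; rewrite -sqrf_eq0 eq_le sqr_ge0 andbT.
apply: (le_of_le_addM K0) => e e0 e1; rewrite add0r.
have [phi tphi phie] := apx _ e0.
have Hphi := H1_0_test tphi; have phi4 := H1_0_L4 Hphi; have [Lphi LDphi _] := Hphi.
have Hr := H1_0_sub_test HF tphi.
set r := (fun x => F x - phi x) in Hr phie; set Dr := (fun x => DF x - _) in Hr phie.
have r4 := H1_0_L4 Hr; have [Lr LDr _] := Hr.
have LWr : L2 Omega (W r) by exact: L2_outer.
have LWphi : L2 Omega (W phi) by exact: L2_outer.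
have WrE : W r = fun x => W F x - W phi x.
  by apply/funext => x; rewrite /W /r mulmxBr.
have bE : L2ip Omega DF (W F) =
    L2ip Omega Dr (W F) + L2ip Omega DF (W r) - L2ip Omega Dr (W r).
  have t0 := convection_test_eq0 uV tphi; rewrite -/(W phi) in t0.
  rewrite WrE !(L2ip_subr mO LWF LWphi)// /Dr !(L2ip_subl mO LDF LDphi)//.
  by rewrite t0; ring.
have rr : L2ip Omega Dr Dr <= e.
  by apply: le_trans (ltW phie); rewrite /H1sq lerDr; exact: L2ip_ge0.
(* [L2ip_outer_le] with s = e, since the fourth powers of r integrate to
   at most C e^2 *)
have Wr : L2ip Omega (W r) (W r) <= e * (U + C).
  apply: le_trans (L2ip_outer_le mO e0 u4 r4) _; rewrite mulrDr lerD2l.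
  have h : \int[leb]_(x in Omega) mxdot (r x) (r x) ^+ 2 <= C * e ^+ 2.
    rewrite -lee_fin fineK; first exact: integral_pow4_le_H1sq phie.
    by case: r4 => _ ?; exact: integrable_fin_num.
  apply: (@le_trans _ _ (e^-1 * (C * e ^+ 2))).
    by rewrite ler_wpM2l// invr_ge0 ltW.
  have -> c : e^-1 * (c * e ^+ 2) = e * c by field; rewrite gt_eqF.
  exact: lexx.
have t1 := le_trans (L2ip_CS mO LDr LWF) (ler_wpM2r X0 rr).
have t2 := le_trans (L2ip_CS mO LDF LWr) (ler_wpM2l Y0 Wr).
have t3 := le_trans (L2ip_CS mO LDr LWr) (ler_pM (L2ip_ge0 _) (L2ip_ge0 _) rr Wr).
rewrite bE.
have alg (a b c q p : R) : 0 <= q -> a ^+ 2 <= e * X -> b ^+ 2 <= Y * (e * q) ->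
    c ^+ 2 <= e * (e * q) -> (a + b - c) ^+ 2 <= 3 * (X + (Y + 1) * q) * e.
  move=> q0 ha hb hc.
  have h1 : e * (e * q) <= 1 * (e * q) by rewrite ler_wpM2r// mulr_ge0// ltW.
  have := sqr_ge0 (a - b); have := sqr_ge0 (a + c); have := sqr_ge0 (b + c).
  by clear - ha hb hc h1; lra.
by apply: alg => //; rewrite addr_ge0.
Qed.

End convection.

(** * The error equation *)

Section H1_linear_structure.
Context {R : realType} {d : nat} {Omega : set 'rV[R]_d}.
Hypothesis oO : open Omega.
Local Notation E := 'rV[R]_d.
Local Notation leb := (@lebesgue_rV R d).

Let mO : measurable Omega := open_measurable_mx oO.

Lemma weak_grad_lin a (v w : H1 Omega) (phi : E -> R) (i j : 'I_d) :
  test_fun Omega phi ->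
  \int[leb]_(x in Omega) ((a *: v x + w x) ord0 j * partial i phi x) =
  - \int[leb]_(x in Omega) ((a *: h1_grad v x + h1_grad w x) i j * phi x).
Proof.
move=> tphi.
have Lp := sL2_test oO tphi; have Ldp := sL2_test oO (test_fun_partial i tphi).
have iv := sL2_integrable mO (sL2_entry mO ord0 j (h1_funL2 v)) Ldp.
have iw := sL2_integrable mO (sL2_entry mO ord0 j (h1_funL2 w)) Ldp.
have idv := sL2_integrable mO (sL2_entry mO i j (h1_gradL2 v)) Lp.
have idw := sL2_integrable mO (sL2_entry mO i j (h1_gradL2 w)) Lp.
transitivity (\int[leb]_(x in Omega) (a * (v x ord0 j * partial i phi x) +
    w x ord0 j * partial i phi x)).
  by apply: eq_Rintegral => x _; rewrite !mxE mulrDl mulrA.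
rewrite RintegralD//; last exact: (integrableZl mO a iv).
rewrite RintegralZl// !h1_weak_grad//.
transitivity (- \int[leb]_(x in Omega) (a * (h1_grad v x i j * phi x) +
    h1_grad w x i j * phi x)).
  rewrite RintegralD//; last exact: (integrableZl mO a idv).
  by rewrite RintegralZl// mulrN -opprD.
by congr (- _); apply: eq_Rintegral => x _; rewrite !mxE mulrDl mulrA.
Qed.

(** The field is literally the linear combination of the fields, as the linearity of
interpolation operators is stated for such functions. *)
Definition H1_lin a (v w : H1 Omega) : H1 Omega :=
  MkH1 (L2_lin mO a (h1_funL2 v) (h1_funL2 w))
       (L2_lin mO a (h1_gradL2 v) (h1_gradL2 w))
       (weak_grad_lin a v w).

Lemma spaceX_lin a (v w : H1 Omega) : spaceX v -> spaceX w -> spaceX (H1_lin a v w).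
Proof.
move=> /spaceX_H1_0 Hv /spaceX_H1_0 Hw; have [_ _ apx] := H1_0_lin oO a Hv Hw.
move=> eps eps0; have eps2 : 0 < eps ^+ 2 by rewrite exprn_gt0.
have [phi tphi h] := apx _ eps2; exists phi; split=> //.
have -> : eps = Num.sqrt (eps ^+ 2) by rewrite sqrtr_sqr gtr0_norm.
by rewrite /H1norm !L2normE ltr_sqrt.
Qed.

Lemma spaceV_lin a (v w : H1 Omega) : spaceV v -> spaceV w -> spaceV (H1_lin a v w).
Proof.
move=> [vX vV] [wX wV]; split; first exact: spaceX_lin.
move=> q qQ; have [mq iq _] := qQ.
have Lq : sL2 (Omega := Omega) q by [].
have iv := sL2_integrable mO (sL2_divergence oO v) Lq.
have iw := sL2_integrable mO (sL2_divergence oO w) Lq.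
transitivity (\int[leb]_(x in Omega) (a * (divergence v x * q x) + divergence w x * q x)).
  apply: eq_Rintegral => x _.
  by rewrite /divergence /= mxtraceD mxtraceZ mulrDl mulrA.
rewrite RintegralD//; last exact: (integrableZl mO a iv).
by rewrite RintegralZl// (vV q qQ) (wV q qQ) mulr0 addr0.
Qed.

End H1_linear_structure.

Section essential_bound.
Context {R : realType} {d : nat} {Omega : set 'rV[R]_d}.
Hypothesis oO : open Omega.
Local Notation E := 'rV[R]_d.
Local Notation leb := (@lebesgue_rV R d).

Let mO : measurable Omega := open_measurable_mx oO.

(** The essential norm is 0 by convention if the whole space is null, in which case any
property holds almost everywhere. *)
Lemma Linfnorm_ae m n (G : E -> 'M[R]_(m, n)) K : Linfnorm Omega G = K%:E ->
  {ae leb, forall x, Omega x -> Num.sqrt (mxdot (G x) (G x)) <= K}.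
Proof.
rewrite /Linfnorm; set g := (fun x => (Num.sqrt _)%:E) \_ Omega.
rewrite unlock; case: ifPn => [_ GK|].
  have := ess_sup_ge leb (abse \o g); rewrite GK.
  apply: filterS => x /= + xO; rewrite /g patchE mem_set//= lee_fin.
  by rewrite ger0_norm// sqrtr_ge0.
rewrite -leNgt => l0 _; exists setT; split=> //.
by apply/eqP; rewrite eq_le l0 measure_ge0.
Qed.

Lemma mxdot_CS m n (A B : 'M[R]_(m, n)) :
  `|mxdot A B| <= Num.sqrt (mxdot A A) * Num.sqrt (mxdot B B).
Proof.
have h : mxdot A B ^+ 2 <= mxdot A A * mxdot B B.
  apply: discriminant_le => [|t]; first exact: mxdot_ge0.
  have := mxdot_ge0 (t *: A + B).
  rewrite !(mxdotDl, mxdotDr, mxdotZl, mxdotZr) (mxdotC B A).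
  by set a := mxdot _ _; set b := mxdot _ _; set c := mxdot _ _; lra.
by rewrite -sqrtrM ?mxdot_ge0// -sqrtr_sqr ler_sqrt// mulr_ge0// mxdot_ge0.
Qed.

(** Pointwise the integrand is at most |G| |r| |e| <= K (|r|^2 + |e|^2) / 2 almost
everywhere. *)
Lemma L2ip_outer_Linf_le (G : E -> 'M[R]_d) (r e : E -> 'rV[R]_d) K :
  Linfnorm Omega G = K%:E -> 0 <= K -> L2 Omega G -> L2 Omega r -> L2 Omega e ->
  L2 Omega (fun x => (r x)^T *m e x) ->
  `|L2ip Omega G (fun x => (r x)^T *m e x)| <=
  K / 2 * (L2ip Omega r r + L2ip Omega e e).
Proof.
move=> GK K0 LG Lr Le Lre; have aeK := Linfnorm_ae GK.
have i1 := L2_integrable mO LG Lre.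
have ir := L2_integrable mO Lr Lr; have ie := L2_integrable mO Le Le.
have i2 : leb.-integrable Omega (EFin \o (fun x => mxdot (r x) (r x) + mxdot (e x) (e x))).
  exact: (integrableD mO ir ie).
have i3 : leb.-integrable Omega (EFin \o (fun x => K / 2 * (mxdot (r x) (r x) + mxdot (e x) (e x)))).
  exact: (integrableZl mO (K / 2) i2).
rewrite -RintegralD// -RintegralZl//.
apply: le_trans (le_normr_Rintegral mO i1) _.
have i4 := integrable_norm i1.
rewrite -lee_fin /Rintegral !fineK; [|exact: integrable_fin_num|exact: integrable_fin_num].
have K2 : 0 <= K / 2 by rewrite divr_ge0.
apply: ae_ge0_le_integral => //.
- exact: measurable_int i4.
- by move=> x _; rewrite lee_fin mulr_ge0// addr_ge0// mxdot_ge0.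
- exact: measurable_int i3.
apply: filterS aeK => x GxK xO; rewrite lee_fin.
apply: le_trans (mxdot_CS _ _) _.
apply: (@le_trans _ _ (K * Num.sqrt (mxdot (r x) (r x) * mxdot (e x) (e x)))).
  by rewrite mxdot_outer ler_wpM2r ?sqrtr_ge0// GxK.
rewrite -mulrA ler_wpM2l// sqrtrM ?mxdot_ge0//.
have := sqr_ge0 (Num.sqrt (mxdot (r x) (r x)) - Num.sqrt (mxdot (e x) (e x))).
rewrite sqrrB !sqr_sqrtr ?mxdot_ge0//; set p := _ * _; clear; lra.
Qed.

End essential_bound.

Section contraction_algebra.
Context {R : realType}.
Implicit Types nu mu : R.

(** For K1 <= 0 the square root of 2 K1 is 0, and the bound on H reads H < 0. *)
Lemma K1_gt0 nu (CI H K1 : R) : 0 < CI -> 0 < H ->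
  H < Num.sqrt nu / (Num.sqrt (2 * K1) * CI) -> 0 < K1.
Proof.
move=> CI0 H0 h; rewrite ltNge; apply/negP => K0.
have s0 : Num.sqrt (2 * K1) = 0 by apply: ler0_sqrtr; rewrite pmulr_rle0.
by move: h; rewrite s0 mul0r invr0 mulr0 ltNge ltW.
Qed.

Lemma damping_rate_gt nu mu (CI H K1 : R) : 0 < nu -> 0 < CI -> 0 < H -> 2 * K1 < mu ->
  H < Num.sqrt nu / (Num.sqrt (2 * K1) * CI) ->
  2 * K1 < Num.min (nu / (CI ^+ 2 * H ^+ 2)) mu.
Proof.
move=> nu0 CI0 H0 hmu hH; have K0 := K1_gt0 CI0 H0 hH.
rewrite lt_min hmu andbT ltr_pdivlMr; last by rewrite mulr_gt0// exprn_gt0.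
have s0 : 0 < Num.sqrt (2 * K1) by rewrite sqrtr_gt0 mulr_gt0.
move: hH; rewrite ltr_pdivlMr; last by rewrite mulr_gt0.
rewrite -ltr_sqr ?nnegrE ?sqrtr_ge0 ?mulr_ge0 ?(ltW H0) ?(ltW s0) ?(ltW CI0)//.
rewrite !exprMn !sqr_sqrtr ?(ltW nu0) ?mulr_ge0 ?(ltW K0)//.
rewrite (_ : 2 * K1 * (CI ^+ 2 * H ^+ 2) = H ^+ 2 * (2 * K1 * CI ^+ 2))//; ring.
Qed.

(** With lam the minimum, the two estimates give lam y <= K1 (x + y), and
2 K1 < lam absorbs K1 y into half of lam y. *)
Lemma energy_contraction (nu mu c K1 a i x y : R) :
  0 < nu -> 0 < c -> 0 < K1 -> 0 <= a -> 0 <= i ->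
  2 * K1 < Num.min (nu / c) mu ->
  nu * a + mu * i <= K1 / 2 * (x + y) ->
  y <= 2 * (c * a) + 2 * i ->
  y <= 2 / (K1^-1 * Num.min (nu / c) mu) * x.
Proof.
move=> nu0 c0 K0 a0 i0; set lam := Num.min _ _ => Klam en yle.
have lc : lam * c <= nu by rewrite -ler_pdivlMr// ge_min lexx.
have lm : lam <= mu by rewrite ge_min lexx orbT.
have lam0 : 0 < lam by lra.
have h1 : lam * c * a <= nu * a by rewrite ler_wpM2r.
have h2 : lam * i <= mu * i by rewrite ler_wpM2r.
have h3 : lam * y <= lam * (2 * (c * a) + 2 * i) by rewrite ler_wpM2l// ltW.
have h4 : lam * y <= K1 * (x + y) by lra.
have [y0|y0] := leP y 0.
  have mu0 : 0 <= mu by exact: ltW (lt_le_trans lam0 lm).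
  have : 0 <= K1 / 2 * (x + y) by apply: le_trans en; rewrite addr_ge0 ?mulr_ge0 ?(ltW nu0).
  rewrite pmulr_rge0 ?divr_gt0// => xy0.
  have x0 : 0 <= x by lra.
  apply: le_trans y0 _; rewrite mulr_ge0//.
  by rewrite divr_ge0// mulr_ge0 ?invr_ge0 ?(ltW K0) ?(ltW lam0).
have h5 : 2 * K1 * y <= lam * y by rewrite ler_wpM2r ?(ltW y0)// ltW.
have -> : 2 / (K1^-1 * lam) * x = 2 * K1 * x / lam by field; rewrite !gt_eqF.
by rewrite ler_pdivlMr// mulrC; lra.
Qed.

Lemma cda_gamma_mono nu (CI K1 H H' mu mu' : R) : 0 < nu -> 0 < CI -> 0 < K1 ->
  0 < H' -> H' < H -> mu < mu' ->
  cda_gamma nu CI K1 H mu < cda_gamma nu CI K1 H' mu'.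
Proof.
move=> nu0 CI0 K0 H'0 H'H mumu; rewrite /cda_gamma ltr_pM2l ?invr_gt0//.
rewrite lt_min !gt_min mumu orbT andbT; apply/orP; left.
have H0 : 0 < H by exact: lt_trans H'H.
have CI2 : 0 < CI ^+ 2 by rewrite exprn_gt0.
rewrite ltr_pM2l// ltf_pV2 ?posrE ?mulr_gt0 ?exprn_gt0//.
by rewrite ltr_pM2l// ltr_sqr ?nnegrE ?(ltW H0) ?(ltW H'0).
Qed.

End contraction_algebra.

Section error_estimate.
Context {R : realType} {d : nat} {Omega : set 'rV[R]_d}.
Hypothesis oO : open Omega.
Hypothesis d23 : d = 2%N \/ d = 3%N.
Local Notation E := 'rV[R]_d.
Local Notation leb := (@lebesgue_rV R d).
Local Notation T := (L2ip Omega).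

Let mO : measurable Omega := open_measurable_mx oO.

Lemma spaceX_L4 (v : H1 Omega) : spaceX v -> L4 (Omega := Omega) v.
Proof. by move=> /spaceX_H1_0 /(H1_0_L4 oO d23). Qed.

Lemma bformE (u w v : H1 Omega) :
  bform u w v = T (h1_grad w) (fun x => (u x)^T *m v x).
Proof. by apply: eq_Rintegral => x _; rewrite mxdot_mulmx. Qed.

(** Linearity of the interpolation operator holds almost everywhere only, which
is enough under the integral. *)
Lemma interpolant_sub CI H IH (u w : H1 Omega) (G : E -> 'rV[R]_d) :
  coarse_interpolation Omega CI H IH -> spaceX u -> spaceX w -> L2 Omega G ->
  T (fun x => IH w x - IH u x) G = T (IH (H1_lin oO (-1) u w)) G.
Proof.
move=> [IL2 Ilin _ _] uX wX LG.
have eX := spaceX_lin oO (-1) uX wX.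
have Ld := L2_sub mO (IL2 _ wX) (IL2 _ uX); have Le := IL2 _ eX.
rewrite /L2ip /Rintegral; congr fine; apply: ae_eq_integral => //.
- exact: measurable_int (L2_integrable mO Ld LG).
- exact: measurable_int (L2_integrable mO Le LG).
have := Ilin (-1) u w uX wX; apply: filterS => x h xO.
by rewrite h// scaleN1r addrC.
Qed.

(** Split e into its interpolant and the interpolation error, which is bounded
by CI H times the gradient of e. *)
Lemma interpolation_split CI H IH (e : H1 Omega) : 0 < CI -> 0 < H ->
  coarse_interpolation Omega CI H IH -> spaceX e ->
  T e e <= 2 * (CI ^+ 2 * H ^+ 2 * T (h1_grad e) (h1_grad e)) + 2 * T (IH e) (IH e).
Proof.
move=> CI0 H0 [IL2 _ Ierr _] eX.
have LI := IL2 _ eX; have Le := h1_funL2 e.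
apply: le_trans (L2ip_triangle oO LI Le) _; rewrite addrC lerD2r ler_wpM2l//.
rewrite -!L2normE -!exprMn ler_sqr ?nnegrE ?L2norm_ge0//; first exact: Ierr.
by rewrite !mulr_ge0 ?L2norm_ge0 ?(ltW CI0) ?(ltW H0).
Qed.

(** Subtract the two equations, both tested with e. As b is linear in its second
argument, b(u_k, u_(k+1), e) - b(u, u, e) = b(u_k, e, e) + b(u_k - u, u, e), where the first term
is zero and the second is bounded by the essential bound of the gradient of u. *)
Lemma picard_energy nu mu f CI H IH K1 (u : H1 Omega) (u_ : nat -> H1 Omega) k
    (e := H1_lin oO (-1) u (u_ k.+1)) (r := H1_lin oO (-1) u (u_ k)) :
  coarse_interpolation Omega CI H IH -> steady_NS nu f u ->
  Linfnorm Omega (h1_grad u) = K1%:E -> 0 <= K1 ->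
  CDA_Picard nu mu f IH u u_ ->
  nu * T (h1_grad e) (h1_grad e) + mu * T (IH e) (IH e) <=
  K1 / 2 * (T r r + T e e).
Proof.
move=> cI uNS0 uK K0 uCDA.
have [uV uNS] := uNS0; have [u_V u_NS] := uCDA.
have eV : spaceV e by exact: spaceV_lin.
have rV : spaceV r by exact: spaceV_lin.
have [uX _] := uV; have [eX _] := eV; have [rX _] := rV.
have [kX _] := u_V k; have [k1X _] := u_V k.+1.
have [IL2 _ _ _] := cI.
have e4 := spaceX_L4 eX; have u4 := spaceX_L4 uX.
have r4 := spaceX_L4 rX; have k4 := spaceX_L4 kX.
have Lke := L2_outer mO k4 e4; have Lue := L2_outer mO u4 e4.
have Lre := L2_outer mO r4 e4.
have LDu := h1_gradL2 u; have LDk := h1_gradL2 (u_ k.+1); have LDe := h1_gradL2 e.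
have eq0 := uNS e eV; have eq1 := u_NS k e eV.
rewrite bformE in eq0; rewrite bformE (interpolant_sub cI uX k1X (IL2 _ eX)) -/e in eq1.
have gradE : T (h1_grad e) (h1_grad e) =
    T (h1_grad (u_ k.+1)) (h1_grad e) - T (h1_grad u) (h1_grad e).
  by rewrite [LHS]L2ip_linl// mulN1r addrC.
have conv : T (h1_grad (u_ k.+1)) (fun x => (u_ k x)^T *m e x) =
    T (h1_grad u) (fun x => (u_ k x)^T *m e x).
  have := convection_eq0 oO d23 (u_V k) (spaceX_H1_0 eX).
  by rewrite L2ip_linl// mulN1r addrC => /eqP; rewrite subr_eq0 => /eqP.
have diff : T (h1_grad u) (fun x => (u_ k x)^T *m e x) -
    T (h1_grad u) (fun x => (u x)^T *m e x) =
    T (h1_grad u) (fun x => (r x)^T *m e x).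
  rewrite -L2ip_subr//; apply: eq_Rintegral => x _; congr mxdot.
  by rewrite -mulmxBl -linearB /= scaleN1r addrC.
have bound := L2ip_outer_Linf_le oO uK K0 LDu (h1_funL2 r) (h1_funL2 e) Lre.
have := ler_norm (- T (h1_grad u) (fun x => (r x)^T *m e x)).
rewrite normrN => /le_trans/(_ bound); apply: le_trans.
rewrite gradE -diff -conv.
move: eq0 eq1; set a := T _ _; set b := T _ _; set c := T _ _; set p := T _ _.
set q := T _ _ => <- h.
rewrite le_eqVlt; apply/orP; left; apply/eqP.
by move/eqP: h; rewrite -subr_eq0 => /eqP h; rewrite -[RHS]addr0 -h; ring.
Qed.

End error_estimate.

(** * Convergence of the iteration *)

Theorem theorem3p1 (R : realType) (d : nat) (hd : d = 2%N \/ d = 3%N)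
  (Omega : set 'rV[R]_d) (hopen : open Omega) (hconn : connected Omega)
  (hbd : convex_polytope Omega \/ smooth_boundary Omega)
  (nu : R) (hnu : 0 < nu)
  (f : ('rV[R]_d -> 'rV[R]_d) -> R) (hf : Hminus1 Omega f)
  (CI : R) (hCI : 0 < CI) (widths : set R)
  (I : R -> ('rV[R]_d -> 'rV[R]_d) -> ('rV[R]_d -> 'rV[R]_d))
  (hI : forall h, widths h -> 0 < h /\ coarse_interpolation Omega CI h (I h))
  (H : R) (hH : widths H) (mu : R) (hmu : 0 < mu)
  (u : H1 Omega) (hu : steady_NS nu f u)
  (K1 : R) (hK1 : Linfnorm Omega (h1_grad u) = K1%:E)
  (u_ : nat -> H1 Omega) (hu_ : CDA_Picard nu mu f (I H) u u_)
  (hmuK1 : 2 * K1 < mu)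
  (hHK1 : H < Num.sqrt nu / (Num.sqrt (2 * K1) * CI)) :
  let gamma := cda_gamma nu CI K1 in
  let err k := L2norm Omega (fun x => u_ k x - u x) in
  [/\ forall k, err k.+1 <= Num.sqrt 2 / Num.sqrt (gamma H mu) * err k,
      2 < gamma H mu,
      Num.sqrt (2 / gamma H mu) < 1 /\ err k @[k --> \oo] --> (0 : R) &
      forall H' mu' : R, 0 < H' -> H' < H -> mu < mu' ->
        Num.sqrt (2 / gamma H' mu') < Num.sqrt (2 / gamma H mu)].
Proof.
move=> gamma err.
have [H0 cI] := hI H hH.
have K0 := K1_gt0 hCI H0 hHK1.
have lamK := damping_rate_gt hnu hCI H0 hmuK1 hHK1.
have g2 : 2 < gamma H mu by rewrite /gamma /cda_gamma mulrC ltr_pdivlMr.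
have g0 : 0 < gamma H mu by exact: lt_trans g2.
have [uV uNS] := hu; have [u_V _] := hu_.
have errE k : err k = L2norm Omega (H1_lin hopen (-1) u (u_ k)).
  by rewrite /err; congr L2norm; apply/funext => x; rewrite /= scaleN1r addrC.
have sqrtE g : 0 < g -> Num.sqrt (2 / g) = Num.sqrt 2 / Num.sqrt g :> R.
  by move=> gg; rewrite sqrtrM// sqrtrV// ltW.
have step k : err k.+1 <= Num.sqrt 2 / Num.sqrt (gamma H mu) * err k.
  rewrite -sqrtE// !errE.
  set e := H1_lin _ _ _ (u_ k.+1); set r := H1_lin _ _ _ (u_ k).
  have [eX _] : spaceV e by exact: spaceV_lin.
  have en := picard_energy hopen hd k cI hu hK1 (ltW K0) hu_.
  have sp := interpolation_split hopen hCI H0 cI eX.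
  have c0 : 0 < CI ^+ 2 * H ^+ 2 by rewrite mulr_gt0 ?exprn_gt0.
  have := energy_contraction hnu c0 K0 (L2ip_ge0 _) (L2ip_ge0 _) lamK en sp.
  rewrite -/(cda_gamma nu CI K1 H mu) -/(gamma H mu) => h.
  rewrite /L2norm -sqrtrM; last by rewrite divr_ge0// ltW.
  have q0 : 0 <= 2 / gamma H mu by rewrite divr_ge0// ltW.
  by rewrite ler_sqrt// mulr_ge0// L2ip_ge0.
have rho1 : Num.sqrt (2 / gamma H mu) < 1.
  by rewrite -[ltRHS]sqrtr1 ltr_sqrt ?ltr01// ltr_pdivrMr ?mul1r.
split=> //.
  split=> //; set rho := Num.sqrt _ in rho1.
  have rho0 : 0 <= rho by exact: sqrtr_ge0.
  have geo k : err k <= rho ^+ k * err 0%N.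
    elim: k => [|k IHk]; first by rewrite expr0 mul1r.
    apply: le_trans (step k) _; rewrite -sqrtE// -/rho exprS -mulrA.
    exact: ler_wpM2l.
  apply: (@squeeze_cvgr _ _ _ _ (fun=> 0) (fun k => rho ^+ k * err 0%N)).
  - by apply: nearW => k; rewrite geo andbT; exact: sqrtr_ge0.
  - exact: cvg_cst.
  - rewrite -[X in _ --> X](mul0r (err 0%N)); apply: cvgMr_tmp.
    by apply: cvg_expr; rewrite ger0_norm.
move=> H' mu' H'0 H'H mumu.
have gg := cda_gamma_mono hnu hCI K0 H'0 H'H mumu.
have g'0 : 0 < gamma H' mu' by exact: lt_trans gg.
by rewrite ltr_sqrt ?divr_gt0// ltr_pM2l// ltf_pV2 ?posrE.
Qed.
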